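(* Let $n\ge1$, $\ell\ge0$ and $m,m'\ge1$ be integers, and let $\hat\ell=\min\{\ell,\lceil n/2\rceil\}$. The containment $$G(\ell,m,n)\cdot G(\ell,m',n)\subseteq G(\ell,m+m',n)$$ is an equality if and only if one of the following holds: (1) $m$ and $m'$ are both even; (2) $m$ and $m'$ are both odd and $\hat\ell\le1$; (3) exactly one of $m,m'$ is odd, and the odd one is at least $\frac{2\hat\ell-3}{3}$.
   Context: For integers $\ell,m\ge 0$ and $n\ge1$, $G(\ell,m,n)$ denotes the set of loopless multigraphs on the labeled vertex set $\{1,\dots,n\}$ with at most $\ell m$ edges (counted with multiplicity) and all vertex degrees at most $m$. A multigraph $G$ is determined by its edge multiplicities $e_G(i,j)$. For multigraphs $G_1,G_2$ on $\{1,\dots,n\}$, the product $G_1\cdot G_2$ is the multigraph with $e_{G_1\cdot G_2}(i,j)=e_{G_1}(i,j)+e_{G_2}(i,j)$ for all $i,j$, and $$G(\ell,m,n)\cdot G(\ell,m',n)=\{G_1\cdot G_2: G_1\in G(\ell,m,n),\ G_2\in G(\ell,m',n)\}.$$ *)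

(* Defs.v *)
From HB Require Import structures.
From mathcomp Require Import all_boot all_order all_algebra.
From mathcomp Require Import boolp classical_sets.

Set Implicit Arguments.
Unset Strict Implicit.
Unset Printing Implicit Defensive.

(* A loopless multigraph on n labeled vertices, given by its edge
   multiplicities e(i, j).  The labels are 0, ..., n - 1.  Both conditions are
   boolean, so that two multigraphs are equal as soon as their multiplicities
   agree. *)
Definition is_multigraph (n : nat) (e : 'M[nat]_n) : bool :=
  [forall i, forall j, e i j == e j i] && [forall i, e i i == 0].

Record multigraph (n : nat) := Multigraph {
  mult :> 'M[nat]_n;
  multP : is_multigraph mult
}.

HB.instance Definition _ (n : nat) := [isSub for @mult n].

Definition degree (n : nat) (G : multigraph n) (i : 'I_n) : nat :=
  \sum_(j < n) G i j.

Definition num_edges (n : nat) (G : multigraph n) : nat :=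
  \sum_(i < n) \sum_(j < n | i < j) G i j.

Lemma mgmul_subproof (n : nat) (G1 G2 : multigraph n) :
  is_multigraph (\matrix_(i, j) (G1 i j + G2 i j)).
Proof.
have /andP[/forallP s1 /forallP l1] := multP G1.
have /andP[/forallP s2 /forallP l2] := multP G2.
apply/andP; split; apply/forallP => i; last first.
  by rewrite mxE (eqP (l1 i)) (eqP (l2 i)).
apply/forallP => j; rewrite !mxE.
by rewrite (eqP (forallP (s1 i) j)) (eqP (forallP (s2 i) j)).
Qed.

Definition mgmul (n : nat) (G1 G2 : multigraph n) : multigraph n :=
  Multigraph (mgmul_subproof G1 G2).

Local Open Scope classical_set_scope.

Definition Gset (l m n : nat) : set (multigraph n) :=
  [set G | (num_edges G <= l * m)%N /\ forall i, (degree G i <= m)%N].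

Arguments Gset : clear implicits.

Definition Gset_mul (n : nat) (A B : set (multigraph n)) : set (multigraph n) :=
  [set mgmul G1 G2 | G1 in A & G2 in B].

Definition lhat (l n : nat) : nat := minn l (uphalf n).

(* Main.v *)
(* Write k = m + m'.  When m' is even, edges of total degree at most 2 per vertex
   can be removed from G step by step, so that one may take m' = 2, k = m + 2.
   Add a vertex [None] absorbing the missing degrees, so that all degrees become
   multiples k * rho(v) of k; one looks for a subgraph with all degrees
   2 * rho(v).  It corresponds to a perfect matching of the graph whose vertices
   are the darts (half-edges) and 2 * rho(v) "cores" at every v, where a dart is
   joined to its twin and to the cores at its source.  Weight m/k on twin pairs
   and 1/(k rho(v)) on dart-core pairs is a fractional perfect matching, so in
   a Tutte obstruction every odd component has boundary weight at least 1, except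
   those formed by a vertex set U left by exactly one edge, of boundary weight
   1 - 2/k.  An obstruction therefore needs k disjoint such sets U.  By parity
   there is none when k is even, and when k is odd each U has at least three
   vertices, which is too many edges if 2 * lhat <= 3 * (m + 1).

   The Berge-Tutte formula is proved by Gallai's argument: if every vertex is
   exposed by some maximum matching, "no maximum matching exposes both u and v"
   is an equivalence relation whose odd classes give the obstruction.

   The bound is sharp: join a centre by single edges to m + 1 triangles whose
   vertices have degree k.  In a splitting each triangle has degree sum 3m in the
   m-part, which is odd, so that the m-part contains all m + 1 central edges. *)

From mathcomp Require Import all_boot all_order all_algebra.
From mathcomp Require Import zify lra ring.
Require Import Defs.

Set Implicit Arguments.
Unset Strict Implicit.
Unset Printing Implicit Defensive.

(** * The Berge-Tutte formula *)

(** The points moved by an involution pair off as [{x, f x}]; the induction removes one such pair at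
    a time. All parity arguments on matchings and darts go through this count. *)
Lemma odd_card_fixpoints (T : finType) (f : T -> T) (C : {set T}) :
  {in C, forall x, f x \in C} -> {in C, forall x, f (f x) = x} ->
  odd #|C| = odd #|[set x in C | f x == x]|.
Proof.
move: {2}#|C| (leqnn #|C|) => s; elim: s C => [|s IH] C leC fC fK.
  have -> : C = set0 by apply/eqP; rewrite -cards_eq0; lia.
  by congr (odd _); apply: eq_card => x; rewrite !inE.
have [/existsP[x /andP[xC fx]]|/existsPn noC] :=
    boolP [exists x, (x \in C) && (f x != x)]; last first.
  congr (odd _); apply: eq_card => x; rewrite inE.
  by case xC: (x \in C) => //=; move: (noC x); rewrite xC /= negbK.
have fxC := fC x xC.
pose C' := C :\ x :\ f x.
have cC : #|C| = #|C'|.+2.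
  by rewrite (cardsD1 x) xC (cardsD1 (f x)) !inE fx fxC.
rewrite cC /= negbK IH; last 3 first.
- lia.
- move=> y; rewrite !inE => /and3P[yfx yx yC]; rewrite fC // andbT.
  apply/andP; split; first by apply: contra yx => /eqP h; rewrite -(fK y) // h fK.
  by apply: contra yfx => /eqP <-; rewrite fK.
- by move=> y; rewrite !inE => /and3P[_ _ yC]; apply: fK.
congr (odd _); apply: eq_card => y; rewrite !inE.
have [->|_] := eqVneq y (f x); first by
  rewrite (fK x) //= [x == f x]eq_sym (negbTE fx) !andbF.
by have [->|_] := eqVneq y x; first by rewrite (negbTE fx) !andbF.
Qed.

Section BergeTutte.

Variables (T : finType) (e : rel T).
Hypothesis e_sym : symmetric e.

(** A matching of the graph induced on [X], encoded as an involution of the whole type that fixes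
    the unmatched vertices and everything outside [X]. Deleting a vertex then changes [X] and not
    the type. *)
Definition matching (X : {set T}) (f : {ffun T -> T}) : bool :=
  [forall x, (f (f x) == x) && ((f x != x) ==> (x \in X) && e x (f x))].

Definition exposed (X : {set T}) (f : {ffun T -> T}) : {set T} :=
  [set x in X | f x == x].

Lemma matchingP (X : {set T}) (f : {ffun T -> T}) :
  reflect (involutive f /\ forall x, f x != x -> x \in X /\ e x (f x))
          (matching X f).
Proof.
apply: (iffP forallP) => [h|[fK fe] x].
  split=> [x|x fx]; first by have /andP[/eqP] := h x.
  by have /andP[_ /implyP/(_ fx)/andP] := h x.
by rewrite fK eqxx /=; apply/implyP => /fe[-> ->].
Qed.

Lemma matching_closed (X : {set T}) (f : {ffun T -> T}) :
  matching X f -> {in X, forall x, f x \in X}.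
Proof.
move=> /matchingP[fK fe] x xX; have [->//|fx] := eqVneq (f x) x.
by have [] := fe (f x); rewrite ?fK // eq_sym.
Qed.

Lemma odd_exposed (X : {set T}) (f : {ffun T -> T}) :
  matching X f -> odd #|exposed X f| = odd #|X|.
Proof.
move=> fM; rewrite (odd_card_fixpoints (matching_closed fM)) // => x _.
by have /matchingP[] := fM.
Qed.

Definition is_maximum (X : {set T}) (f : {ffun T -> T}) : Prop :=
  matching X f /\ forall g, matching X g -> #|exposed X f| <= #|exposed X g|.

Lemma maximum_exists (X : {set T}) : exists f, is_maximum X f.
Proof.
have i0 : matching X [ffun x => x].
  by apply/matchingP; split=> x; rewrite !ffunE // eqxx.
have [f fM fmin] := arg_minnP (fun f => #|exposed X f|) i0.
by exists f.
Qed.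

Lemma maximum_card (X : {set T}) (f g : {ffun T -> T}) :
  is_maximum X f -> is_maximum X g -> #|exposed X f| = #|exposed X g|.
Proof. by move=> [fM fm] [gM gm]; apply/eqP; rewrite eqn_leq fm // gm. Qed.

(** Adding an edge between two exposed vertices would give a larger matching. *)
Lemma maximum_no_edge (X : {set T}) (f : {ffun T -> T}) (x y : T) :
  is_maximum X f -> x \in exposed X f -> y \in exposed X f -> x != y ->
  ~~ e x y.
Proof.
move=> [fM fm]; rewrite !inE => /andP[xX /eqP fx] /andP[yX /eqP fy] xy.
apply/negP => exy; have /matchingP[fK fe] := fM.
pose g := [ffun z => if z == x then y else if z == y then x else f z].
have gM : matching X g.
  apply/matchingP; split=> z; rewrite !ffunE.
    have [->|zx] := eqVneq z x; first by rewrite eqxx eq_sym (negbTE xy).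
    have [->|zy] := eqVneq z y; first by rewrite eqxx.
    case: eqP => [h|_]; first by rewrite -(fK z) h fx eqxx in zx.
    by case: eqP => [h|_]; [rewrite -(fK z) h fy eqxx in zy | exact: fK].
  have [->|zx] := eqVneq z x; first by [].
  by have [->|zy] := eqVneq z y; [rewrite e_sym | exact: fe].
have : exposed X g \proper exposed X f.
  apply/properP; split; last first.
    by exists x; rewrite !inE ?xX ?fx ?eqxx //= ffunE eqxx eq_sym (negbTE xy).
  apply/subsetP=> z; rewrite !inE ffunE.
  have [->|_] := eqVneq z x; first by rewrite xX fx eqxx.
  by have [->|_] := eqVneq z y; first by rewrite yX fy eqxx.
by move=> /proper_card; rewrite ltnNge fm.
Qed.

(* Gallai's argument: rotating an edge of [N] at a vertex that [M] covers and
   [N] exposes brings [N] closer to [M] while keeping [t] exposed. *)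
Lemma gallai_trans (X : {set T}) (M N : {ffun T -> T}) (u v t : T) :
  is_maximum X M -> u \in exposed X M -> v \in exposed X M -> u != v ->
  is_maximum X N -> t \in exposed X N ->
  (exists2 g, is_maximum X g & (t \in exposed X g) && (u \in exposed X g)) \/
  (exists2 g, is_maximum X g & (t \in exposed X g) && (v \in exposed X g)).
Proof.
move=> maxM uM vM uv.
(* The induction is on the number of vertices where [M] and [N] disagree. *)
pose ag (N : {ffun T -> T}) := #|[set x | M x == N x]|.
move: {2}(#|T| - ag N) (leqnn (#|T| - ag N)) => s.
elim: s N => [|s IH] N les maxN tN; have [MM Mm] := maxM; have [NM Nm] := maxN.
  have : [set x | M x == N x] == [set: T].
    by rewrite eqEcard subsetT /= cardsT -subn_eq0 -leqn0.
  move=> /eqP eqMN; have MN x : M x = N x.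
    by apply/eqP; have := in_setT x; rewrite -eqMN inE.
  left; exists M => //; rewrite uM andbT.
  by move: tN; rewrite !inE MN.
have /matchingP[MK Me] := MM; have /matchingP[NK Ne] := NM.
have [uN|uN] := boolP (u \in exposed X N).
  by left; exists N => //; rewrite tN.
have [vN|vN] := boolP (v \in exposed X N).
  by right; exists N => //; rewrite tN.
(* [M] and [N] expose equally many vertices, and [u], [v] are exposed by [M] only. So at least two
   vertices are exposed by [N] only, and one of them is not [t]. *)
have [x] : exists x, x \in (exposed X N :\: exposed X M) :\ t.
  apply/set0Pn; rewrite -card_gt0.
  have h1 := cardsID (exposed X M) (exposed X N).
  have h2 := cardsID (exposed X N) (exposed X M).
  have h3 := maximum_card maxM maxN.
  have : 2 <= #|exposed X M :\: exposed X N|.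
    rewrite -(_ : #|[set u; v]| = 2); last by rewrite cards2 uv.
    by apply: subset_leq_card; rewrite subUset !sub1set !(in_setD, uM, vM, uN, vN).
  have := cardsD1 t (exposed X N :\: exposed X M).
  by rewrite setIC in h1; lia.
rewrite in_setD1 in_setD => /and3P[xt xM xN].
have /andP[xX /eqP Nx] : (x \in X) && (N x == x) by rewrite inE in xN.
have Mx : M x != x by rewrite inE xX in xM.
have [_ exy] := Me _ Mx.
have yX := matching_closed MM xX.
have Ny : N (M x) != M x.
  apply/negP => Ny; have := maximum_no_edge maxN xN (_ : M x \in _).
  by rewrite inE yX Ny eq_sym Mx exy => /(_ isT isT).
set y := M x in exy yX Ny *; set z := N y in Ny *.
have zx : z != x by apply/negP => /eqP h; move: Mx; rewrite -/y -(NK y) -/z h Nx eqxx.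
have [_ eyz] := Ne _ Ny.
have zX := matching_closed NM yX.
have Nz : N z = y by rewrite /z NK.
have My : M y = x by rewrite /y MK.
have xy : x != y by rewrite eq_sym.
(* The edge [yz] of [N] is replaced by the edge [xy] of [M]. The vertex [z] becomes exposed in place
   of [x], so the matching stays maximum. *)
pose N' := [ffun w => if w == x then y else if w == y then x else
                      if w == z then z else N w].
have N'M : matching X N'.
  apply/matchingP; split=> w; rewrite !ffunE.
    have [->|wx] := eqVneq w x; first by rewrite eqxx (negbTE Mx).
    have [->|wy] := eqVneq w y; first by rewrite eqxx.
    have [->|wz] := eqVneq w z; first by rewrite (negbTE zx) (negbTE Ny) eqxx.
    case: eqP => [h|_]; first by rewrite -(NK w) h Nx eqxx in wx.
    case: eqP => [h|_]; first by rewrite -(NK w) h eqxx in wz.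
    by case: eqP => [h|_]; [rewrite -(NK w) h Nz eqxx in wy | exact: NK].
  have [->|wx] := eqVneq w x; first by [].
  have [->|wy] := eqVneq w y; first by rewrite e_sym.
  have [->|wz] := eqVneq w z; first by rewrite eqxx.
  exact: Ne.
have N'exp : exposed X N' = z |: (exposed X N :\ x).
  apply/setP=> w; rewrite !inE ffunE.
  have [->|wx] := eqVneq w x; first by
    rewrite [x == z]eq_sym (negbTE zx) (negbTE Mx) andbF.
  have [->|wy] := eqVneq w y.
    by rewrite (negbTE xy) andbF -/z (negbTE Ny) andbF orbF eq_sym (negbTE Ny).
  by have [->|wz] := eqVneq w z; first by rewrite zX eqxx.
have zN : z \notin exposed X N by rewrite inE zX Nz /= eq_sym.
have maxN' : is_maximum X N'.
  split=> // g /Nm; apply: leq_trans; rewrite N'exp cardsU1 !inE zX /= zx Nz.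
  by rewrite eq_sym Ny (cardsD1 x (exposed X N)) xN.
apply: (IH N') => //; last first.
  rewrite N'exp !inE [t == x]eq_sym xt; move: tN; rewrite inE => ->.
  by rewrite orbT.
suff lt : ag N < ag N'.
  rewrite -ltnS; apply: leq_trans les; apply: ltn_sub2l => //.
  exact: leq_trans lt (max_card _).
apply: proper_card; apply/properP; split; last first.
  by exists x; rewrite !inE ?ffunE ?eqxx //= Nx.
apply/subsetP=> w; rewrite !inE ffunE => /eqP Mw.
have [->|wx] := eqVneq w x; first by rewrite eqxx.
have [->|wy] := eqVneq w y; first by rewrite My.
have [wz|wz] := eqVneq w z; last by rewrite Mw.
by move: wx; rewrite -(MK w) Mw wz Nz My eqxx.
Qed.

(** Induction on [#|X|]. A vertex covered by every maximum matching is deleted and joins [A]; if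
    there is none, [A] is empty and [P] consists of the odd classes of Gallai's relation. Members of
    [P] are odd unions of components of [X :\: A], and need not be connected. *)
Lemma berge_tutte (X : {set T}) :
  exists f (A : {set T}) (P : {set {set T}}),
    [/\ matching X f, A \subset X, trivIset P,
        #|exposed X f| + #|A| <= #|P| &
        forall C, C \in P ->
          [/\ C \subset X :\: A, odd #|C| &
              forall x y, x \in C -> y \in X :\: A -> e x y -> y \in C]].
Proof.
move: {2}#|X| (leqnn #|X|) => s; elim: s X => [|s IH] X leX.
  have -> : X = set0 by apply/eqP; rewrite -cards_eq0; lia.
  have [f [fM _]] := maximum_exists set0.
  exists f, set0, set0; split=> //.
  - by apply/trivIsetP => ? ?; rewrite inE.
  - have -> : exposed set0 f = set0 by apply/setP=> x; rewrite !inE.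
    by rewrite !cards0.
  - by move=> C; rewrite inE.
have [f maxf] := maximum_exists X; have [fM fm] := maxf.
have [[v vX vcov]|allexp] :
   (exists2 v, v \in X & forall g, is_maximum X g -> g v != v)
   \/ (forall v, v \in X -> exists2 g, is_maximum X g & g v == v).
  pose Q v := [exists g,
    [&& matching X g, #|exposed X g| <= #|exposed X f| & g v == v]].
  have [/forall_inP h|/forall_inPn[v vX /existsPn h]] := boolP [forall v in X, Q v].
    right=> v /h/existsP[g /and3P[gM gf gv]]; exists g => //; split=> // g' /fm.
    exact: leq_trans.
  left; exists v => // g maxg; apply/negP => gv; have := h g.
  by rewrite (proj1 maxg) gv (maximum_card maxg maxf) leqnn.
- have [|f' [A [P [f'M AX tP le]]] hP] := IH (X :\ v).
    by rewrite (cardsD1 v) vX in leX; lia.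
  have f'v : f' v = v.
    apply/eqP/negPn/negP => h; have /matchingP[_ /(_ v h)[]] := f'M.
    by rewrite !inE eqxx.
  have f'MX : matching X f'.
    have /matchingP[f'K f'e] := f'M; apply/matchingP; split=> // x /f'e[].
    by rewrite !inE => /andP[].
  have ex' : exposed X f' = v |: exposed (X :\ v) f'.
    apply/setP=> x; rewrite !inE; have [->|//] := eqVneq x v.
    by rewrite vX f'v eqxx.
  have cex' : #|exposed X f'| = #|exposed (X :\ v) f'|.+1.
    by rewrite ex' cardsU1 !inE eqxx.
  have lt : #|exposed X f| < #|exposed X f'|.
    rewrite ltnNge; apply/negP => le'; have := vcov f'.
    rewrite f'v eqxx => h; suff: false by []; apply: h; split=> // g /fm.
    exact: leq_trans.
  (* By parity the strict inequality [lt] is a gap of at least 2: one unit pays for [v], which [f']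
     exposes in [X], the other for adding [v] to [A]. *)
  have par : odd #|exposed X f| = odd #|exposed X f'| by rewrite !odd_exposed.
  have vA : v \notin A.
    by apply/negP => /(subsetP AX); rewrite !inE eqxx.
  have DA : X :\: (v |: A) = X :\ v :\: A.
    by apply/setP=> x; rewrite !inE negb_or; case: (x == v); rewrite ?andbF.
  exists f, (v |: A), P; split=> //; last by move=> C /hP; rewrite DA.
    by rewrite subUset sub1set vX (subset_trans AX) // subD1set.
  rewrite cardsU1 vA; move: lt par le; rewrite cex' /=; lia.
(* Gallai's relation in boolean form: maximality of [g] is tested against [f]. The disjunct [u == v]
   is needed for reflexivity, as every vertex is exposed by some maximum matching. *)
pose R u v := (u == v) || ~~ [exists g,
  [&& matching X g, #|exposed X g| <= #|exposed X f|,
      u \in exposed X g & v \in exposed X g]].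
have RP u v : reflect (u = v \/ forall g, is_maximum X g ->
     ~~ ((u \in exposed X g) && (v \in exposed X g))) (R u v).
  apply: (iffP orP) => [[/eqP->|/existsPn h]|[->|h]]; [by left| |by left|].
    right=> g maxg; have := h g.
    by rewrite (proj1 maxg) (maximum_card maxg maxf) leqnn.
  right; apply/existsPn => g; apply/negP => /and4P[gM gf ug vg].
  have /h : is_maximum X g by split=> // g' /fm; apply: leq_trans.
  by rewrite ug vg.
have Rsym : symmetric R.
  by move=> u v; apply/RP/RP => -[->|h]; [left|right=> g /h; rewrite andbC
     |left|right=> g /h; rewrite andbC].
have Rtrans : {in X & &, forall u t v, R u t -> R t v -> R u v}.
  move=> u t v uX tX vX /RP[->//|h1] /RP[<-|h2]; first by apply/RP; right.
  apply/RP; have [->|uv] := eqVneq u v; [by left | right=> M maxM].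
  apply/negP => /andP[uM vM]; have [N maxN Nt] := allexp t tX.
  have tN : t \in exposed X N by rewrite inE tX.
  case: (gallai_trans maxM uM vM uv maxN tN) => -[g maxg] h.
    by have := h1 g maxg; rewrite andbC h.
  by have := h2 g maxg; rewrite h.
have Req : {in X & &, equivalence_rel R}.
  move=> x y z xX yX zX; split; first by rewrite /R eqxx.
  move=> Rxy; apply/idP/idP; last exact: Rtrans.
  by apply: Rtrans => //; rewrite Rsym.
have Redge x y : e x y -> R x y.
  move=> exy; apply/RP; have [->|xy] := eqVneq x y; [by left|right=> g maxg].
  by apply/negP => /andP[xg yg]; have := maximum_no_edge maxg xg yg xy; rewrite exy.
pose P0 := equivalence_partition R X.
have partP0 : partition P0 X := equivalence_partitionP Req.
have [/eqP covP0 tP0 _] := and3P partP0.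
have inP0 x y : x \in X -> (y \in pblock P0 x) = (y \in X) && R x y.
  move=> xX; have [yX|yX] /= := boolP (y \in X).
    by rewrite (pblock_equivalence_partition Req).
  apply/negbTE; apply: contra yX => yx; rewrite -covP0 -mem_pblock.
  by rewrite (same_pblock tP0 yx).
exists f, set0, [set C in P0 | odd #|C|]; split=> //.
- exact: sub0set.
- by apply/trivIsetP => A B; rewrite !inE => /andP[? _] /andP[? _];
  apply: (trivIsetP tP0).
- rewrite cards0 addn0.
  have inj : {in exposed X f &, injective (pblock P0)}.
    move=> x y xf yf pxy; apply/eqP/negPn/negP => xy.
    have xX : x \in X by move: xf; rewrite inE => /andP[].
    have yX : y \in X by move: yf; rewrite inE => /andP[].
    have : y \in pblock P0 x by rewrite pxy mem_pblock covP0.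
    rewrite inP0 // yX => /RP[h|h]; first by rewrite h eqxx in xy.
    by have := h f maxf; rewrite xf yf.
  rewrite -(card_in_imset inj); apply: subset_leq_card.
  apply/subsetP=> C /imsetP[x xf ->]; have := xf; rewrite inE => /andP[xX fx].
  rewrite inE pblock_mem ?covP0 //=.
  have /matchingP[fK fe] := fM.
  (* Edges stay inside classes, so [f] acts on the class of [x]; two exposed vertices are never
     related, so [x] is its only fixed point and the class is odd. *)
  rewrite (@odd_card_fixpoints _ f) => [||y _ //]; last first.
    move=> y; rewrite !inP0 // => /andP[yX Rxy]; rewrite (matching_closed fM) //=.
    have [->//|fy] := eqVneq (f y) y; have [_ /Redge] := fe _ fy.
    by apply: Rtrans => //; apply: (matching_closed fM).
  suff -> : [set y in pblock P0 x | f y == y] = [set x] by rewrite cards1.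
  apply/setP=> y; rewrite !inE inP0 //; apply/idP/eqP => [|->]; last first.
    by rewrite xX fx /R eqxx.
  move=> /andP[/andP[yX /RP[//|h]] fy]; have := h f maxf.
  by rewrite xf inE yX fy.
move=> C; rewrite inE => /andP[CP oC]; split=> //.
  by rewrite setD0 -covP0; apply: (bigcup_sup C).
move=> x y xC; rewrite setD0 => yX /Redge Rxy.
have xX : x \in X by rewrite -covP0; apply/bigcupP; exists C.
by rewrite -(def_pblock tP0 CP xC) inP0 // yX.
Qed.

End BergeTutte.

(** * Even factors and bridges *)

Lemma setT_sep (S : finType) (p : pred S) : [set x in [set: S] | p x] = [set x | p x].
Proof. by apply/setP => x; rewrite !inE. Qed.

Lemma big_option (T : finType) (F : option T -> nat) :
  \sum_u F u = \sum_t F (Some t) + F None.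
Proof.
rewrite (bigD1 None) //= addnC; congr (_ + _).
rewrite (reindex_omap Some id) => [|[]//]; apply: eq_bigl => t.
by rewrite /= eqxx.
Qed.

(** * Boundary weights in a fractional perfect matching *)

Section FractionalMatching.

Import Order.TTheory GRing.Theory Num.Theory.
Local Open Scope ring_scope.

Variables (T : finType) (y : T -> T -> rat).
Hypotheses (y_sym : forall x z, y x z = y z x) (y_ge0 : forall x z, 0 <= y x z).
Hypothesis y_sum : forall x, \sum_z y x z = 1.

Definition boundary (C : {set T}) : rat :=
  \sum_(x in C) \sum_(z in ~: C) y x z.

(** All weight leaving a member of [P] goes into [A], and each vertex of [A] receives total weight
    at most 1 from the disjoint members. *)
Lemma sum_boundary_le (A : {set T}) (P : {set {set T}}) :
  trivIset P ->
  (forall C x z, C \in P -> x \in C -> z \notin C -> z \notin A -> y x z = 0) ->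
  \sum_(C in P) boundary C <= #|A|%:R.
Proof.
move=> tP PA.
have le1 : \sum_(C in P) boundary C <=
    \sum_(C in P) \sum_(x in C) \sum_(z in A) y x z.
  apply: ler_sum => C CP; apply: ler_sum => x xC.
  rewrite big_mkcond [leRHS]big_mkcond; apply: ler_sum => z _ /=.
  rewrite inE; case: (boolP (z \in C)) => /= zC; first by case: ifP.
  by case: ifP => // /negbT zA; rewrite (PA C).
apply: le_trans le1 _.
rewrite -big_trivIset // exchange_big /=.
rewrite -sum1_card natr_sum; apply: ler_sum => z _.
rewrite -(y_sum z) [leRHS](bigID (mem (cover P))) /=.
under eq_bigr do rewrite y_sym.
by rewrite lerDl sumr_ge0.
Qed.

End FractionalMatching.

(** * The dart graph, its perfect matchings and its Tutte obstructions *)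

Section EvenFactor.

Variables (D V : finType) (tau : D -> D) (vt : D -> V) (rho : V -> nat) (m : nat).
Hypotheses (tauK : involutive tau) (tauN : forall d, tau d != d) (m_gt0 : 0 < m).
Hypothesis card_darts : forall v, #|[set d | vt d == v]| = m.+2 * rho v.

Let core := {v : V & 'I_(2 * rho v)}.

Lemma card_cores v : #|[set c : core | tag c == v]| = 2 * rho v.
Proof.
rewrite -[RHS]card_ord.
rewrite -(card_imset predT (_ : injective
  (fun i : 'I_(2 * rho v) => Tagged _ i : core))).
  apply: eq_card => -[u i]; rewrite !inE /=.
  apply/eqP/imsetP => [h|[j _ /(congr1 tag)]] //.
  by case: _ / h in i *; exists i.
by move=> i j /eqP; rewrite eq_Tagged => /eqP.
Qed.

Let vertex := (D + core)%type.

Definition dart_graph (x z : vertex) : bool :=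
  match x, z with
  | inl d, inl d' => tau d == d'
  | inl d, inr c | inr c, inl d => vt d == tag c
  | inr _, inr _ => false
  end.

Lemma dart_graph_sym : symmetric dart_graph.
Proof.
by case=> [d|c] [d'|c'] //=; rewrite (can2_eq tauK tauK) eq_sym.
Qed.

(** [F] consists of the darts matched to cores. The other darts are matched to their twins, so [F]
    is closed under [tau]; all cores at [v] are matched to darts at [v], which gives the count. *)
Lemma even_factor_of_matching (f : {ffun vertex -> vertex}) :
  matching dart_graph setT f -> exposed setT f = set0 ->
  exists F : {set D}, (forall d, (tau d \in F) = (d \in F)) /\
    forall v, #|[set d in F | vt d == v]| = 2 * rho v.
Proof.
move=> /matchingP[fK fe] f0.
have fN x : f x != x.
  by apply/negP => h; have := in_set0 x; rewrite -f0 !inE h.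
have fE x : dart_graph x (f x) by have [] := fe x (fN x).
pose F := [set d | if f (inl d) is inr _ then true else false].
have Ftau d : d \in F -> tau d \in F.
  rewrite !inE; case E: (f (inl d)) => [//|c] _.
  case E': (f (inl (tau d))) => [d'|//].
  have := fE (inl (tau d)); rewrite E' /= tauK => /eqP d'E.
  by have := fK (inl (tau d)); rewrite E' -d'E E.
exists F; split=> [d|v].
  by apply/idP/idP => /Ftau //; rewrite tauK.
rewrite -card_cores -(card_imset _ (inl_inj : injective (inl : D -> vertex))).
rewrite -[RHS](card_imset _ (_ : injective (fun c : core => f (inr c)))); last first.
  by move=> c c' /(can_inj fK)[].
apply: eq_card => x; apply/imsetP/imsetP => [[d]|[c]].
  rewrite !inE => /andP[]; case E: (f (inl d)) => [//|c] _ /eqP dv ->.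
  exists c; last by rewrite -E fK.
  by have := fE (inl d); rewrite E inE /= dv eq_sym.
rewrite inE => /eqP cv ->; have := fE (inr c).
case E: (f (inr c)) => [d|//] /= /eqP dv.
by exists d => //; rewrite !inE -E fK dv cv eqxx.
Qed.

Import Order.TTheory GRing.Theory Num.Theory.
Local Open Scope ring_scope.

Let k : rat := m.+2%:R.

Definition dart_weight (x z : vertex) : rat :=
  match x, z with
  | inl d, inl d' => (tau d == d')%:R * (m%:R / k)
  | inl d, inr c | inr c, inl d => (vt d == tag c)%:R / (k * (rho (vt d))%:R)
  | inr _, inr _ => 0
  end.

Lemma dart_weight_sym x z : dart_weight x z = dart_weight z x.
Proof.
by case: x z => [d|c] [d'|c'] //=; rewrite (can2_eq tauK tauK) eq_sym.
Qed.

Let k_gt0 : 0 < k. Proof. by rewrite ltr0n. Qed.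

Lemma dart_weight_ge0 x z : 0 <= dart_weight x z.
Proof.
by case: x z => [d|c] [d'|c'] //=; rewrite /k ?(mulr_ge0, invr_ge0, ler0n).
Qed.

Lemma rho_gt0 d : (0 < rho (vt d))%N.
Proof.
rewrite lt0n; apply/negP => /eqP h; have := card_darts (vt d).
rewrite h muln0 => /eqP; rewrite cards_eq0 => /eqP h0.
by have := in_set0 d; rewrite -h0 inE eqxx.
Qed.

Lemma sum_dart_core (U : {set core}) d :
  \sum_(c in U) dart_weight (inl d) (inr c) =
  #|[set c in U | tag c == vt d]|%:R / (k * (rho (vt d))%:R).
Proof.
rewrite /= -mulr_suml -sum1_card natr_sum; congr (_ / _).
rewrite [RHS]big_mkcond [LHS]big_mkcond; apply: eq_bigr => c _.
by rewrite inE [tag c == _]eq_sym; case: (c \in U) => //=; case: eqP.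
Qed.

Lemma sum_core_dart (U : {set D}) (c : core) :
  \sum_(d in U) dart_weight (inr c) (inl d) =
  #|[set d in U | vt d == tag c]|%:R / (k * (rho (tag c))%:R).
Proof.
rewrite /= -sum1_card natr_sum mulr_suml.
rewrite [RHS]big_mkcond [LHS]big_mkcond; apply: eq_bigr => d _.
by rewrite inE; case: (d \in U) => //=; case: eqP => [->|]; rewrite ?mul0r.
Qed.

(** A dart has weight [m / k] towards its twin and [2 / k] in total towards the [2 * rho v] cores at
    its source [v]; a core at [v] meets [k * rho v] darts with weight [1 / (k * rho v)] each. *)
Lemma dart_weight_sum x : \sum_z dart_weight x z = 1.
Proof.
case: x => [d|c]; rewrite big_sumType /=.
  rewrite (bigD1 (tau d)) //= eqxx big1 => [|d' /negbTE h]; last first.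
    by rewrite eq_sym h mul0r.
  have := sum_dart_core setT d; rewrite /= (eq_bigl _ _ (in_setT (T:=_))) => ->.
  rewrite setT_sep card_cores natrM.
  have : (rho (vt d))%:R != 0 :> rat by rewrite pnatr_eq0 -lt0n rho_gt0.
  have : k != 0 by rewrite gt_eqF.
  have -> : k = m%:R + 2 by rewrite /k -addn2 natrD.
  by move=> h1 h2; field; rewrite h1 h2.
rewrite big1_eq addr0.
have := sum_core_dart setT c; rewrite /= (eq_bigl _ _ (in_setT (T:=_))) => ->.
rewrite setT_sep card_darts natrM divff // mulf_neq0 //; first by rewrite gt_eqF.
by rewrite pnatr_eq0; case: c => v i /=; case: (rho v) i => // -[].
Qed.

(* A set [C] of vertices of [dart_graph] of boundary weight below 1 contains
   all or none of the cores at each [v]; [tags C] is the set of those [v]. *)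
Definition tags (C : {set vertex}) : {set V} :=
  [set v | [exists c : core, (tag c == v) && (inr c \in C)]].

Definition twin_cut (C : {set vertex}) : {set D} :=
  [set d | (inl d \in C) && (inl (tau d) \notin C)].

(** Darts separated by [C] from the cores at their source, when those cores are not themselves split
    by [C]. *)
Definition mismatch (C : {set vertex}) : {set D} :=
  [set d | (inl d \in C) != (vt d \in tags C)].

Definition core_part (C : {set vertex}) : {set core} := [set c | inr c \in C].

(** Every edge has a dart end, so the boundary can be charged to darts: a twin pair to its dart
    inside [C], a dart-core edge to its dart on either side. *)
Lemma boundary_darts (C : {set vertex}) :
  boundary dart_weight C =
  \sum_d (if inl d \in C then
            (inl (tau d) \notin C)%:R * (m%:R / k) +
            \sum_(c in ~: core_part C) dart_weight (inl d) (inr c)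
          else \sum_(c in core_part C) dart_weight (inl d) (inr c)).
Proof.
rewrite /boundary big_sumType /=.
have -> : \sum_(c : core | inr c \in C) \sum_(z in ~: C) dart_weight (inr c) z =
    \sum_(d | inl d \notin C) \sum_(c in core_part C) dart_weight (inl d) (inr c).
  under eq_bigr do rewrite big_sumType /= [X in _ + X]big1 // addr0.
  rewrite exchange_big /=; apply: eq_big => [d|d _]; first by rewrite inE.
  by apply: eq_bigl => c; rewrite inE.
rewrite [RHS](bigID (fun d => inl d \in C)) /=; congr (_ + _); last first.
  by apply: eq_bigr => d /negbTE ->.
apply: eq_bigr => d dC; rewrite dC big_sumType /=; congr (_ + _); last first.
  by apply: eq_bigl => c; rewrite !inE.
rewrite big_mkcond (bigD1 (tau d)) //= eqxx big1 ?addr0.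
  by rewrite inE; case: (inl (tau d) \in C); rewrite /= ?mul0r.
by move=> d' /negbTE h; rewrite eq_sym h mul0r; case: ifP.
Qed.

(** If cores at [v] lie on both sides, each of the [k * rho v] darts at [v] sends at least
    [1 / (k * rho v)] across, whichever side it is on. *)
Lemma boundary_mixed (C : {set vertex}) (c c' : core) :
  tag c = tag c' -> inr c \in C -> inr c' \notin C -> 1 <= boundary dart_weight C.
Proof.
move=> cc' cC c'C; rewrite boundary_darts.
have sum1 : \sum_(d | vt d == tag c) (k * (rho (tag c))%:R)^-1 = 1.
  rewrite sumr_const -[X in _ *+ X](_ : #|[set d | vt d == tag c]| = _); last first.
    by apply: eq_card => d; rewrite !inE.
  rewrite card_darts -[LHS]mulr_natr natrM -/k mulVf // mulf_neq0 //.
    by rewrite gt_eqF.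
  by rewrite pnatr_eq0; case: c {cc' cC} => v i /=; case: (rho v) i => // -[].
rewrite -[leLHS]sum1 big_mkcond; apply: ler_sum => d _.
case: ifP => [/eqP dc|_]; last first.
  case: ifP => _; last by apply: sumr_ge0 => a _;
    apply: (dart_weight_ge0 (inl d) (inr a)).
  apply: addr_ge0; last by apply: sumr_ge0 => a _;
    apply: (dart_weight_ge0 (inl d) (inr a)).
  by rewrite mulr_ge0 ?divr_ge0 ?ler0n ?(ltW k_gt0).
have le1 (W : {set core}) (b : core) : b \in W -> tag b = tag c ->
    (k * (rho (tag c))%:R)^-1 <= \sum_(c in W) dart_weight (inl d) (inr c).
  move=> bW bc; rewrite (bigD1 b) //= dc bc eqxx mul1r lerDl.
  by apply: sumr_ge0 => a _; rewrite -dc; apply: (dart_weight_ge0 (inl d) (inr a)).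
case: ifP => _; last by apply: (le1 _ c); rewrite ?inE.
apply: le_trans (le1 (~: core_part C) c' _ _) _ => //; first by rewrite !inE.
by rewrite lerDr mulr_ge0 ?divr_ge0 ?ler0n ?(ltW k_gt0).
Qed.

(** A cut twin pair costs [m / k]; a misplaced dart is cut from all [2 * rho v] cores at its source
    and costs [2 / k]. *)
Lemma boundary_unmixed (C : {set vertex}) :
  (forall c : core, (inr c \in C) = (tag c \in tags C)) ->
  boundary dart_weight C = (m * #|twin_cut C| + 2 * #|mismatch C|)%:R / k.
Proof.
move=> pureC; rewrite boundary_darts.
have kE : 2 + m%:R != 0 :> rat by rewrite -natrD pnatr_eq0.
have rn0 d : (rho (vt d))%:R != 0 :> rat by rewrite pnatr_eq0 -lt0n rho_gt0.
have card_in_part d : #|[set c in core_part C | tag c == vt d]| =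
    if vt d \in tags C then (2 * rho (vt d))%N else 0%N.
  case: ifP => h; [rewrite -card_cores; apply: eq_card | apply: eq_card0] => c;
    rewrite !inE pureC; case: eqP => [->|]; rewrite ?andbF ?h //.
have card_out_part d : #|[set c in ~: core_part C | tag c == vt d]| =
    if vt d \in tags C then 0%N else (2 * rho (vt d))%N.
  case: ifP => h; [apply: eq_card0 | rewrite -card_cores; apply: eq_card] => c;
    rewrite !inE pureC; case: eqP => [->|]; rewrite ?andbF ?h //.
transitivity (\sum_d ((d \in twin_cut C)%:R * (m%:R / k) +
                      (d \in mismatch C)%:R * (2 / k))).
  apply: eq_bigr => d _; rewrite !sum_dart_core card_in_part card_out_part.
  rewrite [d \in twin_cut C]in_set [d \in mismatch C]in_set.
  by case: (inl d \in C); case: (vt d \in tags C); case: (inl (tau d) \in C) => /=;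
    rewrite ?natrM; field; rewrite rn0 kE.
rewrite big_split -!mulr_suml /=.
have cardE (S : {set D}) : \sum_d (d \in S)%:R = #|S|%:R :> rat.
  by rewrite -sum1_card natr_sum [RHS]big_mkcond; apply: eq_bigr => d _; case: ifP.
by rewrite !cardE natrD !natrM; field; rewrite kE.
Qed.

(** Cores enter [C] in even groups of [2 * rho v] and uncut darts in twin pairs, so the parity of
    [C] is that of its cut darts. *)
Lemma odd_twin_cut (C : {set vertex}) :
  (forall c : core, (inr c \in C) = (tag c \in tags C)) -> odd #|C| ->
  odd #|twin_cut C|.
Proof.
move=> pureC.
have cardC : #|C| = (#|[set d | inl d \in C]| + #|core_part C|)%N.
  by rewrite -sum1_card big_sumType /= !sum1dep_card.
have even_cores : ~~ odd #|core_part C|.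
  rewrite -sum1_card (partition_big (fun c : core => tag c) (mem (tags C))) /=;
    last first.
    by move=> c; rewrite inE pureC.
  elim/big_ind: _ => [//|a b|v vC]; first by rewrite oddD => /negbTE-> /negbTE->.
  rewrite sum1dep_card -[X in ~~ odd X](_ : #|[set c : core | tag c == v]| = _).
    by rewrite card_cores oddM.
  by apply: eq_card => c; rewrite !inE pureC; case: eqP => [->|]; rewrite ?vC ?andbF.
have even_in : ~~ odd #|[set d | (inl d \in C) && (inl (tau d) \in C)]|.
  rewrite (@odd_card_fixpoints _ tau) => [|d|d _]; last by rewrite tauK.
    suff -> : [set d in [set d | (inl d \in C) && (inl (tau d) \in C)] |
               tau d == d] = set0.
      by rewrite cards0.
    by apply/setP => d; rewrite !inE (negbTE (tauN d)) andbF.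
  by rewrite !inE tauK andbC.
rewrite cardC oddD (negbTE even_cores) addbF.
rewrite -(cardsID [set d | inl (tau d) \in C]) oddD.
rewrite -[X in odd X (+) _](_ :
   #|[set d | (inl d \in C) && (inl (tau d) \in C)]| = _); last first.
  by apply: eq_card => d; rewrite !inE.
rewrite (negbTE even_in) /=.
rewrite -[X in odd X -> _](_ : #|twin_cut C| = _) //.
by apply: eq_card => d; rewrite !inE andbC.
Qed.

(* Parity makes the number of cut twin pairs odd, and both three such pairs and
   one such pair together with one misplaced dart already weigh at least 1. *)
Lemma boundary_odd (C : {set vertex}) :
  odd #|C| -> 1 <= boundary dart_weight C \/
  [/\ boundary dart_weight C = m%:R / k, #|twin_cut C| = 1%N,
      forall c : core, (inr c \in C) = (tag c \in tags C) &
      forall d, (inl d \in C) = (vt d \in tags C)].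
Proof.
move=> oddC.
have [/existsP[c /existsP[c' /and3P[/eqP cc' cC c'C]]]|nomix] :=
  boolP [exists c : core, exists c' : core,
           [&& tag c == tag c', inr c \in C & inr c' \notin C]].
  by left; apply: boundary_mixed cc' cC c'C.
have pureC (c : core) : (inr c \in C) = (tag c \in tags C).
  rewrite inE; apply/idP/existsP => [cC|[b /andP[/eqP bc bC]]].
    by exists c; rewrite eqxx.
  apply/negPn/negP => cC; case/existsP: nomix; exists b; apply/existsP; exists c.
  by rewrite bc eqxx bC.
have oddcut := odd_twin_cut pureC oddC; rewrite (boundary_unmixed pureC).
have [lt|] := boolP (m * #|twin_cut C| + 2 * #|mismatch C| < m.+2)%N; last first.
  by rewrite -leqNgt => le; left; rewrite ler_pdivlMr // mul1r ler_nat.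
have cut1 : #|twin_cut C| = 1%N.
  by move: oddcut lt; case: #|twin_cut C| => [|[|[|a]]] // _; nia.
have mis0 : #|mismatch C| = 0%N by rewrite cut1 in lt; lia.
right; split=> //; first by rewrite cut1 mis0 muln1 addn0.
move=> d; apply/eqP/negPn/negP => h; have := in_set0 d.
by move/eqP: mis0; rewrite cards_eq0 => /eqP <-; rewrite inE h.
Qed.

(** The sets in [B] are the vertex sets underlying the obstruction's members of boundary weight
    below 1. The last clause, that no bridge ends in another member of [B], holds because the far
    dart of each bridge lies in [A]. *)
Lemma even_factor_or_bridges :
  (exists F : {set D}, (forall d, (tau d \in F) = (d \in F)) /\
     forall v, #|[set d in F | vt d == v]| = (2 * rho v)%N) \/
  (exists B : {set {set V}},
     [/\ (m.+2 <= #|B|)%N, trivIset B,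
         forall U, U \in B ->
           #|[set d | (vt d \in U) && (vt (tau d) \notin U)]| = 1%N &
         forall U d, U \in B -> vt d \in U -> vt (tau d) \notin U ->
           vt (tau d) \notin cover B]).
Proof.
have [f [A [P [fM _ tP leP hP]]]] := berge_tutte dart_graph_sym [set: vertex].
have [f0|fn0] := eqVneq (exposed setT f) set0.
  by left; apply: (even_factor_of_matching fM f0).
right.
have even_vertex : ~~ odd #|[set: vertex]|.
  have even_darts : ~~ odd #|D|.
    rewrite -cardsT (@odd_card_fixpoints _ tau) => [||d _]; rewrite ?tauK //.
    suff -> : [set d in setT | tau d == d] = set0 by rewrite cards0.
    by apply/setP => d; rewrite !inE (negbTE (tauN d)).
  have even_cores : ~~ odd #|{: core}|.
    rewrite -sum1_card (partition_big (fun c : core => tag c) predT) //=.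
    elim/big_ind: _ => [//|a b|v _]; first by rewrite oddD => /negbTE-> /negbTE->.
    by rewrite sum1dep_card card_cores oddM.
  by rewrite cardsT card_sum oddD (negbTE even_darts) (negbTE even_cores).
(* The number of vertices is even, so a nonzero number of exposed ones is at least 2. *)
have le2 : (2 + #|A| <= #|P|)%N.
  apply: leq_trans leP; rewrite leq_add2r.
  have := odd_exposed fM; rewrite (negbTE even_vertex).
  by move: fn0; rewrite -card_gt0; case: #|exposed _ _| => [|[|]].
have PA C x z : C \in P -> x \in C -> z \notin C -> z \notin A -> ~~ dart_graph x z.
  move=> CP xC zC zA; have [_ _ closedC] := hP C CP.
  by apply: contra zC; apply: closedC => //; rewrite !inE zA.
have y0 x z : ~~ dart_graph x z -> dart_weight x z = 0.
  by case: x z => [d|c] [d'|c'] //= /negbTE->; rewrite mul0r.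
have le_sum := sum_boundary_le dart_weight_sym dart_weight_ge0 dart_weight_sum tP
  (fun C x z CP xC zC zA => y0 x z (PA C x z CP xC zC zA)).
pose bad := [set C in P | boundary dart_weight C < 1].
have badP C : C \in bad ->
    [/\ boundary dart_weight C = m%:R / k, #|twin_cut C| = 1%N,
      forall c : core, (inr c \in C) = (tag c \in tags C) &
      forall d, (inl d \in C) = (vt d \in tags C)].
  rewrite inE => /andP[CP lt1]; have [_ oddC _] := hP C CP.
  by case: (boundary_odd oddC) => // /(lt_le_trans lt1); rewrite ltxx.
have bad_sub C : C \in bad -> C \in P by rewrite inE => /andP[].
(* Summing [1 - boundary] over [P] gives at least [#|P| - #|A|], hence at least 2. Only bad members
   contribute positively, by [2 / k] each, so there are at least [k] of them. *)
have card_bad : (m.+2 <= #|bad|)%N.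
  have : #|P|%:R - #|A|%:R <= #|bad|%:R * (2 / k).
    apply: le_trans (lerB (lexx _) le_sum) _.
    rewrite -[#|P|]sum1_card natr_sum -sumrB (bigID (mem bad)) /=.
    have -> : #|bad|%:R * (2 / k) = \sum_(C in P | C \in bad) (2 / k) + 0.
      rewrite addr0 (eq_bigl (mem bad)) => [|C]; first by
        rewrite sumr_const mulr_natl.
      by rewrite /= !inE; case: (C \in P).
    apply: lerD.
      apply: ler_sum => C /andP[_ /badP[-> _ _ _]].
      by rewrite lerBlDr -mulrDl ler_pdivlMr // mul1r -natrD ler_nat.
    apply: sumr_le0 => C /andP[CP]; rewrite inE CP /= -leNgt.
    by rewrite subr_le0.
  have le2R : 2 <= #|P|%:R - #|A|%:R :> rat by rewrite lerBrDr -natrD ler_nat.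
  move=> /(le_trans le2R); rewrite mulrA ler_pdivlMr // mulrC ler_pM2r //.
  by rewrite ler_nat.
have tags_neq0 C : C \in bad -> exists2 d, d \in twin_cut C & vt d \in tags C.
  move=> Cb; have [_ cut1 _ dC] := badP C Cb.
  have /set0Pn[d dcut] : twin_cut C != set0 by rewrite -card_gt0 cut1.
  by exists d => //; rewrite -dC; move: dcut; rewrite inE => /andP[].
have tags_meet C C' v : C \in bad -> C' \in bad -> v \in tags C -> v \in tags C' ->
    C = C'.
  move=> Cb C'b; rewrite inE => /existsP[c /andP[/eqP <- cC]].
  have [_ _ <- _] := badP C' C'b => cC'; apply/eqP/negPn/negP => CC'.
  have /disjoint_setI0 h := trivIsetP tP _ _ (bad_sub _ Cb) (bad_sub _ C'b) CC'.
  by have := in_set0 (inr c : vertex); rewrite -h inE cC cC'.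
have cutE C d : C \in bad ->
    (vt d \in tags C) && (vt (tau d) \notin tags C) = (d \in twin_cut C).
  by move=> Cb; have [_ _ _ dC] := badP C Cb; rewrite [RHS]in_set !dC.
exists (tags @: bad); split.
- rewrite card_in_imset // => C C' Cb C'b tCC'.
  have [d _ dC] := tags_neq0 C Cb; apply: (tags_meet _ _ (vt d)) => //.
  by rewrite -tCC'.
- apply/trivIsetP => _ _ /imsetP[C Cb ->] /imsetP[C' C'b ->] neq.
  rewrite -setI_eq0; apply/eqP/setP => v; rewrite in_set0 in_setI; apply/negP.
  move=> /andP[vC vC']; move: neq.
  by rewrite (tags_meet _ _ _ Cb C'b vC vC') eqxx.
- move=> _ /imsetP[C Cb ->]; have [_ cut1 _ _] := badP C Cb; rewrite -cut1.
  by apply: eq_card => d; rewrite inE cutE.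
move=> _ d /imsetP[C Cb ->] dC tdC.
have dcut : d \in twin_cut C by rewrite -cutE // dC.
apply/negP => /bigcupP[_ /imsetP[C' C'b ->]].
have [_ _ _ <-] := badP C' C'b => tdC'.
have tdA : inl (tau d) \in A.
  apply/negPn/negP => tdA; move: dcut; rewrite inE => /andP[d1 d2].
  by have := PA C _ _ (bad_sub _ Cb) d1 d2 tdA; rewrite /= eqxx.
have [/subsetP/(_ _ tdC')] := hP C' (bad_sub _ C'b).
by rewrite inE tdA.
Qed.

End EvenFactor.

Lemma card_preim_sum (D V : finType) (vt : D -> V) (S : {set D}) (U : {set V}) :
  #|[set d in S | vt d \in U]| = \sum_(v in U) #|[set d in S | vt d == v]|.
Proof.
rewrite -sum1dep_card (partition_big vt (mem U)) => [|d /andP[]//].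
apply: eq_bigr => v /= vU; rewrite sum1dep_card; apply: eq_card => d.
by rewrite !inE; case: eqP => [->|_]; rewrite ?andbF // vU !andbT.
Qed.

Lemma card_preim_cover (D V : finType) (vt : D -> V) (S : {set D})
    (B : {set {set V}}) : trivIset B ->
  #|[set d in S | vt d \in cover B]| =
  \sum_(U in B) #|[set d in S | vt d \in U]|.
Proof.
move=> tB; rewrite card_preim_sum big_trivIset //.
by apply: eq_bigr => U _; rewrite card_preim_sum.
Qed.

(** * Excluding the obstruction by counting darts *)

Section FewBridges.

Variables (D W : finType) (tau : D -> D) (vt : D -> option W).
Variables (rho : option W -> nat) (m : nat).
Hypotheses (tauK : involutive tau) (tauN : forall d, tau d != d).
Hypothesis card_darts : forall v, #|[set d | vt d == v]| = m.+2 * rho v.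
Hypothesis rho1 : forall w, rho (Some w) = 1.
Hypothesis loopless : forall d, vt d != None -> vt (tau d) != vt d.

Lemma card_dartsU (U : {set option W}) :
  None \notin U -> #|[set d | vt d \in U]| = m.+2 * #|U|.
Proof.
move=> nU; have := card_preim_sum vt setT U; rewrite setT_sep => ->.
rewrite -sum1_card big_distrr /=; apply: eq_bigr => -[w|] vU.
  by rewrite setT_sep card_darts rho1.
by rewrite vU in nU.
Qed.

(** Darts whose twin also starts in [U] pair off, leaving only the bridge. *)
Lemma odd_bridge (U : {set option W}) :
  #|[set d | (vt d \in U) && (vt (tau d) \notin U)]| = 1 ->
  odd #|[set d | vt d \in U]|.
Proof.
move=> cut1; rewrite -(cardsID [set d | vt (tau d) \in U]) oddD.
rewrite -[X in _ (+) odd X](_ :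
   #|[set d | (vt d \in U) && (vt (tau d) \notin U)]| = _).
  rewrite cut1 addbT (@odd_card_fixpoints _ tau) => [|d|d _]; rewrite ?tauK //.
    rewrite (_ : [set x in _ | _] = set0) ?cards0 //.
    by apply/setP => d; rewrite !inE (negbTE (tauN d)) andbF.
  by rewrite !inE tauK andbC.
by apply: eq_card => d; rewrite !inE andbC.
Qed.

(** [m.+2 * #|U|] is odd, so [#|U|] is odd. A single vertex is impossible: having no loops, it would
    send all of its [m.+2] darts out. *)
Lemma bridge_side_ge3 (U : {set option W}) :
  #|[set d | (vt d \in U) && (vt (tau d) \notin U)]| = 1 ->
  None \notin U -> 3 * m.+2 <= #|[set d | vt d \in U]|.
Proof.
move=> cut1 nU; have := odd_bridge cut1; rewrite card_dartsU // oddM => /andP[_ oU].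
rewrite mulnC leq_mul2l /=.
have : #|U| != 1.
  apply/negP => /cards1P[v Uv]; move: cut1.
  rewrite -[X in X = _](_ : #|[set d | vt d \in U]| = _).
    by rewrite card_dartsU // Uv cards1 muln1.
  apply: eq_card => d; rewrite !inE; case dU: (vt d \in U) => //=; apply/esym.
  move: dU; rewrite Uv !inE => /eqP dv; rewrite -dv loopless // dv.
  by move: nU; rewrite Uv !inE eq_sym.
by move: oU; case: #|U| => [|[|[|]]].
Qed.

(** For even [m] every [U] has an even number of darts, against [odd_bridge]. Otherwise the darts
    with both ends different from [None] are counted. *)
Lemma few_bridges (B : {set {set option W}}) :
  ~~ odd m \/
    #|[set d | (vt d != None) && (vt (tau d) != None)]| <= 3 * m.+1 * m.+2 ->
  m.+2 <= #|B| -> trivIset B ->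
  (forall U, U \in B ->
     #|[set d | (vt d \in U) && (vt (tau d) \notin U)]| = 1) ->
  (forall U d, U \in B -> vt d \in U -> vt (tau d) \notin U ->
     vt (tau d) \notin cover B) -> False.
Proof.
move=> bound cB tB cut1 out.
case: bound => [even_m|bound].
  have [U UB] : exists U, U \in B by apply/set0Pn; rewrite -card_gt0; lia.
  have := odd_bridge (cut1 U UB).
  have := card_preim_sum vt setT U; rewrite setT_sep => ->.
  apply/negP; elim/big_ind: _ => [//|a b|v _].
    by rewrite oddD => /negbTE-> /negbTE->.
  by rewrite setT_sep card_darts oddM /= negbK (negbTE even_m).
set Z := [set d | _] in bound.
have [nB|nB] := boolP (None \in cover B); last first.
  (* Only the bridge can lead from [U] to [None], whence the loss of 1; still, [m.+2] such sets
     exceed the bound. *)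
  have geZ U : U \in B -> 3 * m.+2 - 1 <= #|[set d in Z | vt d \in U]|.
    move=> UB; have nU : None \notin U.
      by apply: contra nB => nU; apply/bigcupP; exists U.
    rewrite leq_subLR; apply: leq_trans (bridge_side_ge3 (cut1 U UB) nU) _.
    rewrite -(cardsID Z) addnC -(cut1 U UB) leq_add //; apply: subset_leq_card.
      apply/subsetP => d; rewrite !inE negb_and !negbK => /andP[dN dU]; rewrite dU /=.
      by case/orP: dN => /eqP dN; [rewrite -dN dU in nU | rewrite dN].
    by apply/subsetP => d; rewrite !inE andbC.
  have : #|B| * (3 * m.+2 - 1) <= #|Z|.
    apply: leq_trans (_ : #|[set d in Z | vt d \in cover B]| <= _); last first.
      by apply: subset_leq_card; apply/subsetP => d; rewrite inE => /andP[].
    by rewrite card_preim_cover // -sum_nat_const leq_sum.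
  move/leq_trans => /(_ _ bound); nia.
have /bigcupP[U0 U0B nU0] := nB.
have nU U : U \in B :\ U0 -> None \notin U.
  rewrite !inE => /andP[neq UB]; apply/negP => nU.
  have /disjoint_setI0 h := trivIsetP tB _ _ UB U0B neq.
  by have := in_set0 (None : option W); rewrite -h inE nU nU0.
have inB U : U \in B :\ U0 -> U \in B by rewrite inE => /andP[].
(* As [None] lies in the cover, no other bridge ends there, so all darts of the remaining sets
   belong to [Z]. *)
have twinU U d : U \in B :\ U0 -> vt d \in U -> vt (tau d) != None.
  move=> UB dU; apply/negP => /eqP h.
  by have := out U d (inB U UB) dU; rewrite h nB nU // => /(_ isT).
have tB' : trivIset (B :\ U0).
  by apply/trivIsetP => X Y /inB XB /inB YB; apply: (trivIsetP tB).
have [U UB] : exists U, U \in B :\ U0.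
  by apply/set0Pn; rewrite -card_gt0; rewrite (cardsD1 U0) U0B in cB; lia.
have [d] : exists d, d \in [set d | (vt d \in U) && (vt (tau d) \notin U)].
  by apply/set0Pn; rewrite -card_gt0 cut1 // inB.
rewrite inE => /andP[dU tdU].
have tdB := out U d (inB _ UB) dU tdU.
(* The remaining [m.+1] or more sets only reach the bound [3 * m.+1 * m.+2]; the far dart [tau d] of
   a bridge lies in [Z] but outside the cover and exceeds it. *)
have : #|B :\ U0| * (3 * m.+2) <= #|Z :\ tau d|.
  apply: leq_trans (_ : #|[set d in Z | vt d \in cover (B :\ U0)]| <= _).
    rewrite card_preim_cover // -sum_nat_const leq_sum // => X XB.
    apply: leq_trans (bridge_side_ge3 (cut1 X (inB _ XB)) (nU X XB)) _.
    apply: subset_leq_card; apply/subsetP => c; rewrite !inE => cX.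
    by rewrite cX (twinU X) // !andbT; apply: contraNneq (nU X XB) => <-.
  apply: subset_leq_card; apply/subsetP => c; rewrite in_setD1 inE => /andP[-> cB'].
  rewrite andbT; apply/negP => /eqP h; case/negP: tdB; rewrite -h.
  by case/bigcupP: cB' => X /inB XB cX; apply/bigcupP; exists X.
have tdZ : tau d \in Z.
  rewrite inE tauK (twinU U) //=; apply: contraNneq (nU U UB) => <- //.
have := cardsD1 (tau d) Z; rewrite tdZ; move: bound cB.
rewrite (cardsD1 U0 B) U0B; move: #|Z| #|Z :\ tau d| #|B :\ U0| => a b c.
by nia.
Qed.

End FewBridges.

(** * Multigraphs *)

Lemma mult_sym n (G : multigraph n) i j : G i j = G j i.
Proof. by have /andP[/forallP/(_ i)/forallP/(_ j)/eqP] := multP G. Qed.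

Lemma mult_diag n (G : multigraph n) i : G i i = 0.
Proof. by have /andP[_ /forallP/(_ i)/eqP] := multP G. Qed.

Lemma multigraph_ext n (G H : multigraph n) : (forall i j, G i j = H i j) -> G = H.
Proof. by move=> GH; apply: val_inj; apply/matrixP. Qed.

Lemma multigraph_of n (h : 'I_n -> 'I_n -> nat) :
  (forall i j, h i j = h j i) -> (forall i, h i i = 0) ->
  exists G : multigraph n, forall i j, G i j = h i j.
Proof.
move=> h_sym h_diag.
have hP : is_multigraph (\matrix_(i, j) h i j).
  apply/andP; split; apply/forallP => i; last by rewrite mxE h_diag.
  by apply/forallP => j; rewrite !mxE h_sym.
by exists (Multigraph hP) => i j; rewrite /= mxE.
Qed.

Lemma mgmulE n (G H : multigraph n) i j : mgmul G H i j = G i j + H i j.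
Proof. by rewrite mxE. Qed.

Lemma mgmulC n (G H : multigraph n) : mgmul G H = mgmul H G.
Proof. by apply: multigraph_ext => i j; rewrite !mgmulE addnC. Qed.

Lemma mgmulA n (G H K : multigraph n) :
  mgmul G (mgmul H K) = mgmul (mgmul G H) K.
Proof. by apply: multigraph_ext => i j; rewrite !mgmulE addnA. Qed.

Lemma degree_mgmul n (G H : multigraph n) i :
  degree (mgmul G H) i = degree G i + degree H i.
Proof. by rewrite /degree -big_split; apply: eq_bigr => j _; rewrite mgmulE. Qed.

Lemma num_edges_mgmul n (G H : multigraph n) :
  num_edges (mgmul G H) = num_edges G + num_edges H.
Proof.
rewrite /num_edges -big_split; apply: eq_bigr => i _; rewrite -big_split.
by apply: eq_bigr => j _; rewrite mgmulE.
Qed.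

Lemma mgmul_complement n (G H : multigraph n) :
  (forall i j, H i j <= G i j) -> exists K, mgmul K H = G.
Proof.
move=> HG; have [||K KE] := @multigraph_of n (fun i j => G i j - H i j).
- by move=> i j; rewrite (mult_sym G) (mult_sym H).
- by move=> i; rewrite !mult_diag.
by exists K; apply: multigraph_ext => i j; rewrite mgmulE KE subnK.
Qed.

Lemma sum_degree n (G : multigraph n) : \sum_i degree G i = 2 * num_edges G.
Proof.
rewrite mul2n -addnn /num_edges.
have {2}-> : \sum_(i < n) \sum_(j < n | i < j) G i j =
             \sum_(i < n) \sum_(j < n | j < i) G i j.
  rewrite (exchange_big_dep predT) //=.
  by apply: eq_bigr => i _; apply: eq_bigr => j _; rewrite mult_sym.
rewrite -big_split; apply: eq_bigr => i _ /=.
rewrite /degree (bigID (fun j : 'I_n => i < j)) /=; congr (_ + _).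
rewrite (bigID (fun j : 'I_n => j < i)) /= [X in _ + X]big1 ?addn0 => [|j].
  by apply: eq_bigl => j; case: ltngtP.
by rewrite -!leqNgt -eqn_leq => /eqP/val_inj ->; rewrite mult_diag.
Qed.

Lemma degree_le_num_edges n (G : multigraph n) i : degree G i <= num_edges G.
Proof.
suff: degree G i + degree G i <= \sum_j degree G j by rewrite sum_degree; lia.
rewrite (bigD1 i) //= leq_add2l {1}/degree (bigD1 i) //= mult_diag add0n.
by apply: leq_sum => j _; rewrite mult_sym /degree (bigD1 i) //= leq_addr.
Qed.

(** * Removing a subgraph of maximum degree at most two *)

Section RemoveDegreeTwo.

Variables (n m r : nat) (G : multigraph n).
Hypotheses (m_gt0 : 0 < m) (degG : forall i, degree G i <= m.+2).

Let deficiency := \sum_i (m.+2 - degree G i).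

Hypotheses (def_le : deficiency <= m.+2 * r)
           (def_odd : odd deficiency = odd (m.+2 * r)).
Hypothesis bound : ~~ odd m \/ 2 * num_edges G <= 3 * m.+1 * m.+2.

(* The vertex [None] absorbs all missing degrees; its [m.+2 * r - deficiency]
   remaining darts form loops. *)
Definition closure_mult (u v : option 'I_n) : nat :=
  match u, v with
  | Some i, Some j => G i j
  | Some i, None | None, Some i => m.+2 - degree G i
  | None, None => m.+2 * r - deficiency
  end.

Lemma closure_mult_sym u v : closure_mult u v = closure_mult v u.
Proof. by case: u v => [i|] [j|] //=; rewrite mult_sym. Qed.

Let arc := (option 'I_n * option 'I_n)%type.
Let dart := {p : arc & 'I_(closure_mult p.1 p.2)}.

Let src (d : dart) : option 'I_n := (tag d).1.

(** The index is reversed so that [twin] has no fixed point on the loops at [None], whose darts are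
    even in number. *)
Definition twin (d : dart) : dart :=
  Tagged (fun p : arc => 'I_(closure_mult p.1 p.2)) (i := ((tag d).2, (tag d).1))
    (cast_ord (closure_mult_sym (tag d).1 (tag d).2) (rev_ord (tagged d))).

Lemma dart_eq (d d' : dart) :
  tag d = tag d' -> (tagged d : nat) = tagged d' -> d = d'.
Proof.
case: d d' => p i [q j] /= E; case: _ / E in j * => ij.
by rewrite (val_inj ij : i = j).
Qed.

Lemma twinK : involutive twin.
Proof.
move=> d; apply: dart_eq; first by case: d => -[].
case: d => -[u v] i /=; have := ltn_ord i; rewrite /= (closure_mult_sym v u); lia.
Qed.

Lemma even_loops : ~~ odd (m.+2 * r - deficiency).
Proof. by rewrite oddB // def_odd addbb. Qed.

Lemma twinN d : twin d != d.
Proof.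
apply/negP => /eqP; case: d => -[u v] i h.
have [vu] := congr1 tag h; move: (congr1 (fun d : dart => (tagged d : nat)) h) => /=.
subst v; have := ltn_ord i; move: i {h} => i /=.
move=> lt eqi.
have : odd (closure_mult u u) by lia.
case: u {i lt eqi} => [i|] /=; first by rewrite mult_diag.
by rewrite (negbTE even_loops).
Qed.

Lemma card_tag (S : {set dart}) (u : option 'I_n) :
  #|[set d in S | src d == u]| = \sum_v #|[set d in S | tag d == (u, v)]|.
Proof.
rewrite -sum1dep_card (partition_big (fun d => (tag d).2) predT) //=.
apply: eq_bigr => v _; rewrite sum1dep_card; apply: eq_card => d.
by rewrite !inE /src -andbA; case: (tag d) => a b /=; rewrite xpair_eqE.
Qed.

Lemma card_arc (u v : option 'I_n) :
  #|[set d : dart | tag d == (u, v)]| = closure_mult u v.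
Proof.
rewrite -[RHS]card_ord.
rewrite -(card_imset predT (_ : injective
  (fun i : 'I_(closure_mult u v) =>
     Tagged (fun p : arc => 'I_(closure_mult p.1 p.2)) (i := (u, v)) i : dart))).
  apply: eq_card => -[p i]; rewrite !inE /=.
  apply/eqP/imsetP => [h|[j _ /(congr1 tag)]] //.
  by subst p; exists i.
by move=> i j /eqP; rewrite eq_Tagged => /eqP.
Qed.

Let rho (u : option 'I_n) : nat := if u is Some _ then 1 else r.

Lemma card_src u : #|[set d : dart | src d == u]| = m.+2 * rho u.
Proof.
have := card_tag setT u; rewrite setT_sep => ->.
under eq_bigr do rewrite setT_sep card_arc.
rewrite big_option; case: u => [i|] /=; last by rewrite -/deficiency subnKC.
by rewrite -/(degree G i) subnKC ?muln1.
Qed.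

Lemma card_inner :
  #|[set d | (src d != None) && (src (twin d) != None)]| = 2 * num_edges G.
Proof.
rewrite -sum_degree -sum1dep_card.
rewrite (partition_big (fun d : dart => src d) predT) //= big_option.
rewrite [X in _ + X]big_pred0 ?addn0 => [|d]; last first.
  by rewrite /src; case: (tag d).1 => [a|]; rewrite /= ?andbF.
apply: eq_bigr => i _; rewrite /degree.
rewrite (partition_big (fun d : dart => (tag d).2) predT) //= big_option.
rewrite [X in _ + X]big_pred0 ?addn0 => [|d]; last first.
  by rewrite /src /=; case: (tag d).2 => [a|]; rewrite /= ?andbF.
apply: eq_bigr => j _; rewrite sum1dep_card -[RHS]/(closure_mult (Some i) (Some j)).
rewrite -card_arc; apply: eq_card => -[[u v] t]; rewrite !inE /src /= xpair_eqE.
by case: u {t} => [a|]; case: v => [b|]; rewrite /= ?andbF ?andbT.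
Qed.

(** [H] is the even factor restricted to the true vertices. It loses at most the missing degree at
    each vertex, whence the third clause. If the deficiency is exactly [m.+2 * r], there are no
    loops at [None], and exactly [2 * r] edges of the factor are lost. *)
Lemma remove_degree_two : exists H : multigraph n,
  [/\ forall i j, H i j <= G i j, forall i, degree H i <= 2,
      forall i, degree G i <= m + degree H i &
      deficiency = m.+2 * r -> num_edges H + r = n].
Proof.
have loopless d : src d != None -> src (twin d) != src d.
  case: d => -[u v] i; rewrite /src /= => un; apply/negP => /eqP vu; subst v.
  by case: u i un => [a|//] [t lt]; have := lt; rewrite /= mult_diag.
have inner : ~~ odd m \/
    #|[set d | (src d != None) && (src (twin d) != None)]| <= 3 * m.+1 * m.+2.
  by rewrite card_inner.
case: (@even_factor_or_bridges _ _ twin src rho m twinK twinN m_gt0 card_src);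
  last first.
  case=> B [cB tB cut1 out].
  by have := few_bridges twinK twinN card_src
    (fun _ => erefl) loopless inner cB tB cut1 out.
case=> F [Ftwin Fdeg].
pose h u v := #|[set d in F | tag d == (u, v)]|.
have h_sym u v : h u v = h v u.
  rewrite /h -(card_imset _ (can_inj twinK)); apply: eq_card => d; rewrite inE.
  apply/imsetP/andP => [[c]|[dF /eqP dE]].
    by rewrite inE => /andP[cF /eqP cE] ->; rewrite Ftwin cF /= cE.
  by exists (twin d); rewrite ?twinK // inE Ftwin dF /= dE.
have h_le u v : h u v <= closure_mult u v.
  rewrite -card_arc; apply: subset_leq_card; apply/subsetP => d.
  by rewrite !inE => /andP[].
have h_sum u : \sum_v h u v = 2 * rho u by rewrite -card_tag Fdeg.
have [||H HE] := @multigraph_of n (fun i j => h (Some i) (Some j)).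
- by move=> i j; rewrite h_sym.
- by move=> i; apply/eqP; rewrite -leqn0 -(mult_diag G i) h_le.
have H_deg i : degree H i + h (Some i) None = 2.
  by have := h_sum (Some i); rewrite big_option /= muln1 => <-;
    congr (_ + _); apply: eq_bigr.
exists H; split.
- by move=> i j; rewrite HE; apply: h_le.
- by move=> i; rewrite -(H_deg i) leq_addr.
- move=> i; have := H_deg i; have := h_le (Some i) None => /=.
  by have := degG i; lia.
move=> def_eq.
have hN : \sum_i h (Some i) None = 2 * r.
  have := h_sum None; rewrite big_option /= => <-.
  have := h_le None None; rewrite /= def_eq subnn leqn0 => /eqP ->; rewrite addn0.
  by apply: eq_bigr => i _; apply: h_sym.
have : \sum_(i < n) (degree H i + h (Some i) None) = \sum_(i < n) 2.
  exact: eq_bigr.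
rewrite big_split /= sum_degree hN sum_nat_const card_ord; lia.
Qed.

End RemoveDegreeTwo.

(** * Splittings *)

Lemma mg0_exists n : exists Z : multigraph n,
  [/\ forall i j, Z i j = 0, num_edges Z = 0 & forall i, degree Z i = 0].
Proof.
have [//|//|Z ZE] := @multigraph_of n (fun _ _ => 0).
exists Z; split=> // [|i]; last by rewrite /degree big1.
by rewrite /num_edges big1 // => i _; rewrite big1.
Qed.

Lemma single_edge n (i j : 'I_n) : i != j ->
  exists E : multigraph n,
    [/\ forall a b, E a b = ((a == i) && (b == j) || (a == j) && (b == i)),
        forall a, degree E a = (a == i) + (a == j) & num_edges E = 1].
Proof.
move=> ij.
have [a b|a|E EE] := @multigraph_of n
    (fun a b => (a == i) && (b == j) || (a == j) && (b == i)).
- by rewrite orbC ![(b == _) && _]andbC.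
- by case: eqP => [->|]; rewrite ?(negbTE ij) ?andbF.
have Edeg a : degree E a = (a == i) + (a == j).
  rewrite /degree; under eq_bigr do rewrite EE.
  have [->|ai] := eqVneq a i.
    rewrite (negbTE ij) (bigD1 j) //= eqxx big1 // => b /negbTE bj.
    by rewrite bj.
  have [_|_] := eqVneq a j; last by rewrite big1.
  by rewrite (bigD1 i) //= eqxx big1 // => b /negbTE bi; rewrite bi.
exists E; split=> //; have := sum_degree E.
under eq_bigr do rewrite Edeg.
rewrite big_split /= (bigD1 i) //= eqxx big1 => [|a /negbTE->//].
rewrite (bigD1 j) //= eqxx big1 => [|a /negbTE->//].
lia.
Qed.

(** Transfers a splitting of a larger multigraph to [G]: [K'] is the minimum of [G] and [K], and
    [H'] is the rest. *)
Lemma mgmul_decrease n (G K H : multigraph n) :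
  (forall i j, G i j <= mgmul K H i j) ->
  exists K' H', [/\ mgmul K' H' = G, forall i j, K' i j <= K i j &
                    forall i j, H' i j <= H i j].
Proof.
move=> le.
have [||K' K'E] := @multigraph_of n (fun i j => minn (G i j) (K i j)).
- by move=> i j; rewrite (mult_sym G) (mult_sym K).
- by move=> i; rewrite mult_diag min0n.
have [i j|H' GE] := @mgmul_complement n G K'; first by rewrite K'E geq_minl.
exists K', H'; split=> [|i j|i j]; first by rewrite mgmulC.
  by rewrite K'E geq_minr.
have := le i j; have := mgmulE H' K' i j; rewrite GE mgmulE K'E; lia.
Qed.

Lemma Gset_sub l m n (G H : multigraph n) :
  (forall i j, H i j <= G i j) -> Gset l m n G -> Gset l m n H.
Proof.
move=> HG [eG dG]; have [K KG] := mgmul_complement HG; split.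
  by rewrite (leq_trans _ eG) // -KG num_edges_mgmul leq_addl.
by move=> i; rewrite (leq_trans _ (dG i)) // -KG degree_mgmul leq_addl.
Qed.

Lemma Gset_mgmul l m m' n (G H : multigraph n) :
  Gset l m n G -> Gset l m' n H -> Gset l (m + m') n (mgmul G H).
Proof.
move=> [eG dG] [eH dH]; split; first by rewrite num_edges_mgmul mulnDr leq_add.
by move=> i; rewrite degree_mgmul leq_add.
Qed.

Definition splits (l m m' n : nat) (G : multigraph n) : Prop :=
  exists K H, [/\ Gset l m n K, Gset l m' n H & mgmul K H = G].

Lemma splitsC l m m' n (G : multigraph n) : splits l m m' G -> splits l m' m G.
Proof. by case=> K [H [hK hH <-]]; exists H, K; rewrite mgmulC. Qed.

Lemma deficiencyE n k (G : multigraph n) : (forall i, degree G i <= k) ->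
  \sum_i (k - degree G i) + 2 * num_edges G = n * k.
Proof.
move=> dG; rewrite -sum_degree -big_split /= -[n in RHS]card_ord -sum_nat_const.
by apply: eq_bigr => i _; rewrite subnK.
Qed.

(** A single vertex accounts for at most [k] of the total deficiency. *)
Lemma two_deficient n k (G : multigraph n) : k < \sum_i (k - degree G i) ->
  exists i j, [/\ i != j, degree G i < k & degree G j < k].
Proof.
move=> ltk.
have [/existsP[i di]|/existsPn no] := boolP [exists i, degree G i < k]; last first.
  by move: ltk; rewrite big1 // => i _; apply/eqP; rewrite subn_eq0 leqNgt.
have [/existsP[j /andP[ji dj]]|/existsPn no] :=
    boolP [exists j, (j != i) && (degree G j < k)].
  by exists i, j; rewrite eq_sym.
move: ltk; rewrite (bigD1 i) //= big1 ?addn0 => [|j ji]; first by lia.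
by have := no j; rewrite ji -leqNgt /= => ?; apply/eqP; rewrite subn_eq0.
Qed.

(** For [n <= 2 * l] the edge bounds follow from the degree bounds. Otherwise edges are added to [G]
    until it has exactly [l * m.+2], which makes the removed part have exactly [2 * l] edges. *)
Lemma splits_two l m n (G : multigraph n) : 0 < m ->
  ~~ odd m \/ 2 * lhat l n <= 3 * m.+1 ->
  Gset l m.+2 n G -> splits l m 2 G.
Proof.
move=> m_gt0 cond.
have [le_n2l|lt_2ln] := leqP n (2 * l).
  move=> [eG dG]; have defE := deficiencyE dG.
  (* With [r = n] the size and parity conditions hold, since the deficiency is [n * m.+2] minus
     twice the number of edges. *)
  have [|||H [HG dH dGH _]] := @remove_degree_two n m n G m_gt0 dG.
  - by rewrite [m.+2 * n]mulnC -defE leq_addr.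
  - by rewrite [m.+2 * n]mulnC -defE oddD oddM addbF.
  - case: cond => [|bound]; [by left | right].
    have : n * m.+2 <= 3 * m.+1 * m.+2.
      by rewrite leq_mul2r; move: bound; rewrite /lhat; lia.
    by lia.
  have [K KG] := mgmul_complement HG; exists K, H; split=> //.
    have dK i : degree K i <= m.
      by have := dGH i; rewrite -{1}KG degree_mgmul; lia.
    split=> //; have : 2 * num_edges K <= n * m; last by nia.
    by rewrite -sum_degree -[n in leqRHS]card_ord -sum_nat_const leq_sum.
  split=> //; have : 2 * num_edges H <= n * 2; last by lia.
  by rewrite -sum_degree -[n in leqRHS]card_ord -sum_nat_const leq_sum.
move: {2}(l * m.+2 - num_edges G) (erefl (l * m.+2 - num_edges G)) => s.
elim: s G => [|s IH] G sE [eG dG]; have defE := deficiencyE dG.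
  have eGE : num_edges G = l * m.+2 by lia.
  have def_eq : \sum_i (m.+2 - degree G i) = m.+2 * (n - 2 * l).
    by rewrite eGE in defE; nia.
  have [|||H [HG dH dGH /(_ def_eq) eH]] :=
      @remove_degree_two n m (n - 2 * l) G m_gt0 dG.
  - by rewrite def_eq.
  - by rewrite def_eq.
  - case: cond => [|bound]; [by left | right].
    rewrite eGE mulnA leq_mul2r /=; apply: leq_trans bound.
    by rewrite /lhat; lia.
  have [K KG] := mgmul_complement HG; exists K, H; split=> //.
    split; first by have := num_edges_mgmul K H; rewrite KG eGE; nia.
    by move=> i; have := dGH i; rewrite -{1}KG degree_mgmul; lia.
  by split=> //; lia.
(* An edge is still missing and [2 * l < n], so the deficiency exceeds [m.+2] and an edge can be
   added between two deficient vertices. *)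
have [|i [j [ij di dj]]] := @two_deficient n m.+2 G.
  have : num_edges G < l * m.+2 by lia.
  by move: defE; nia.
have [E [EE dE eE]] := single_edge ij.
have [||K [H [hK hH KH]]] := IH (mgmul G E).
- by rewrite num_edges_mgmul eE; lia.
- split; first by rewrite num_edges_mgmul eE; lia.
  move=> a; rewrite degree_mgmul dE.
  have [->|ai] := eqVneq a i; first by rewrite (negbTE ij); lia.
  by have [->|aj] := eqVneq a j; [lia | rewrite !addn0].
have [|K' [H' [GE K'K H'H]]] := @mgmul_decrease n G K H.
  by move=> a b; rewrite KH mgmulE leq_addr.
by exists K', H'; split=> //; [apply: Gset_sub hK | apply: Gset_sub hH].
Qed.

(** Degree 2 is peeled off [b] times; the condition for [m] implies the one for each [m + 2 * b]. *)
Lemma splits_even l m n b (G : multigraph n) : 0 < m ->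
  ~~ odd m \/ 2 * lhat l n <= 3 * m.+1 ->
  Gset l (m + 2 * b) n G -> splits l m (2 * b) G.
Proof.
move=> m_gt0 cond; elim: b G => [|b IH] G hG.
  have [Z [ZE eZ dZ]] := mg0_exists n; exists G, Z; split.
  - by rewrite muln0 addn0 in hG.
  - by split=> [|i]; rewrite ?eZ ?dZ.
  - by apply: multigraph_ext => i j; rewrite mgmulE ZE addn0.
have [|||G' [H1 [hG' hH1 <-]]] := @splits_two l (m + 2 * b) n G.
- by rewrite addn_gt0 m_gt0.
- case: cond => [em|bound]; [left | right].
    by rewrite oddD (negbTE em) oddM.
  by apply: leq_trans bound _; rewrite leq_mul2l /= ltnS leq_addr.
- by rewrite -[_.+2]addn2 -addnA -mulnSr.
have [K [H [hK hH <-]]] := IH G' hG'.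
exists K, (mgmul H H1); split=> //; last by rewrite mgmulA.
by rewrite mulnSr; apply: Gset_mgmul.
Qed.

Lemma num_edges_split n m m' (G : multigraph n) : num_edges G <= m + m' ->
  exists K H, [/\ mgmul K H = G, num_edges K <= m & num_edges H <= m'].
Proof.
elim: m' G => [|m' IH] G leG; have [Z [ZE eZ dZ]] := mg0_exists n.
  exists G, Z; rewrite eZ -[m]addn0; split=> //.
  by apply: multigraph_ext => i j; rewrite mgmulE ZE addn0.
have [/existsP[i /existsP[j Gij]]|/existsPn no] :=
    boolP [exists i, exists j, 0 < G i j].
  have ij : i != j.
    by apply/negP => /eqP h; move: Gij; rewrite h mult_diag.
  have [E [EE _ eE]] := single_edge ij.
  have [|G' G'E] := @mgmul_complement n G E.
    move=> a b; rewrite EE; case: orP => //= -[]/andP[/eqP-> /eqP->] //.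
    by rewrite mult_sym.
  have [|K [H [KH eK eH]]] := IH G'.
    by move: leG; rewrite -G'E num_edges_mgmul eE; lia.
  exists K, (mgmul H E); rewrite mgmulA KH num_edges_mgmul eE; split=> //; lia.
exists Z, Z; rewrite eZ; split=> //.
apply: multigraph_ext => i j; rewrite mgmulE ZE; apply/esym/eqP.
by have /existsPn/(_ j) := no i; rewrite lt0n negbK.
Qed.

(** Here [G] has at most [m + m'] edges, and any division of them by number works, because a degree
    never exceeds the number of edges. *)
Lemma splits_small l m m' n (G : multigraph n) :
  lhat l n <= 1 -> Gset l (m + m') n G -> splits l m m' G.
Proof.
move=> lhat_le [eG dG].
have leG : num_edges G <= m + m'.
  move: lhat_le; rewrite /lhat geq_min => /orP[l1|n2].
    by apply: leq_trans eG _; rewrite -[leqRHS]mul1n leq_mul2r l1 orbT.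
  have := deficiencyE dG; have : n * (m + m') <= 2 * (m + m').
    by rewrite leq_mul2r; move: n2; lia.
  lia.
have [K [H [KH eK eH]]] := num_edges_split leG.
have eKH := num_edges_mgmul K H; rewrite KH in eKH.
exists K, H; split=> //; split=> [|i].
- by case: l eG {lhat_le} => [|l]; rewrite ?mul0n ?mulSn; lia.
- exact: leq_trans (degree_le_num_edges K i) eK.
- by case: l eG {lhat_le} => [|l]; rewrite ?mul0n ?mulSn; lia.
- exact: leq_trans (degree_le_num_edges H i) eH.
Qed.

(** * Obstructions *)

Lemma sum_ord_support n (F : nat -> nat) (s : seq nat) :
  uniq s -> all (fun j => j < n) s -> (forall j, j \notin s -> F j = 0) ->
  \sum_(j < n) F j = \sum_(j <- s) F j.
Proof.
move=> us /allP sn F0; rewrite -(big_mkord xpredT F) (bigID (mem s)) /=.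
rewrite [X in _ + X]big1 ?addn0 => [|j /F0 //].
rewrite -big_filter; apply: perm_big; apply: uniq_perm => //.
  by rewrite filter_uniq // iota_uniq.
move=> j; rewrite mem_filter mem_index_iota leq0n /=.
by case js: (j \in s) => //=; rewrite sn.
Qed.

(** Natural-number indices let vertices be named by expressions such as [3 * q + 1]. *)
Definition entry n (G : multigraph n.+1) (i j : nat) : nat := G (inord i) (inord j).

Lemma degree_entry n (G : multigraph n.+1) (i : nat) (s : seq nat) :
  uniq s -> all (fun j => j < n.+1) s ->
  (forall j, j < n.+1 -> j \notin s -> entry G i j = 0) ->
  degree G (inord i) = \sum_(j <- s) entry G i j.
Proof.
move=> us sn G0; rewrite /degree.
transitivity (\sum_(j < n.+1) (if j < n.+1 then entry G i j else 0)).
  by apply: eq_bigr => j _; rewrite ltn_ord /entry inord_val.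
rewrite (@sum_ord_support _ (fun j => if j < n.+1 then entry G i j else 0) s) //.
  by rewrite big_seq [RHS]big_seq; apply: eq_bigr => j /(allP sn) ->.
by move=> j js; case: ifP => // jn; apply: G0.
Qed.

Lemma entry_mgmul n (G H : multigraph n.+1) i j :
  entry (mgmul G H) i j = entry G i j + entry H i j.
Proof. exact: mgmulE. Qed.

Lemma entry_sym n (G : multigraph n.+1) i j : entry G i j = entry G j i.
Proof. exact: mult_sym. Qed.

Lemma num_edges_bound n N k (G : multigraph n) : N <= n ->
  (forall i, degree G i <= if i < N then k else 0) -> 2 * num_edges G <= N * k.
Proof.
move=> Nn dG; rewrite -sum_degree.
apply: (@leq_trans (\sum_(i < n) (if i < N then k else 0))).
  by apply: leq_sum => i _; apply: dG.
rewrite -big_mkcond -(big_ord_widen n (fun=> k)) //.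
by rewrite sum_nat_const card_ord.
Qed.

Lemma degree_tight n l m m' (G K H : multigraph n) i :
  mgmul K H = G -> Gset l m n K -> Gset l m' n H -> degree G i = m + m' ->
  degree K i = m.
Proof.
move=> <- [_ /(_ i) dK] [_ /(_ i) dH]; rewrite degree_mgmul; lia.
Qed.

(** The witness is a triangle with all multiplicities [(m + m') / 2]. Its vertices have full degree,
    so the [m]-part would have the odd degree sum [3 * m]. *)
Lemma odd_odd_not_split l m m' n : odd m -> odd m' -> 1 < lhat l n ->
  exists2 G : multigraph n, Gset l (m + m') n G & ~ splits l m m' G.
Proof.
move=> om om'; rewrite /lhat leq_min => /andP[l2].
case: n => [//|[//|[//|n']]] _; set n := n'.+2.
pose s := (m + m')./2.
have ss : s + s = m + m' by rewrite addnn /s even_halfK // oddD om om'.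
pose f (i j : nat) := if [&& i < 3, j < 3 & i != j] then s else 0.
have [||G GE] := @multigraph_of n.+1 (fun i j => f i j).
- by move=> i j; rewrite /f eq_sym andbCA.
- by move=> i; rewrite /f eqxx !andbF.
have GfE i j : i < n.+1 -> j < n.+1 -> entry G i j = f i j.
  by move=> lti ltj; rewrite /entry GE !inordK.
have deg3 (X : multigraph n.+1) (i a b : nat) :
    (forall u v, entry X u v <= entry G u v) ->
    perm_eq [:: i; a; b] [:: 0; 1; 2] ->
    degree X (inord i) = entry X i a + entry X i b.
  move=> XG p3; have up : uniq [:: i; a; b] by rewrite (perm_uniq p3).
  have mem3 x : x \in [:: i; a; b] = (x < 3).
    by rewrite (perm_mem p3) !inE; lia.
  rewrite (@degree_entry _ _ _ [:: a; b]) ?big_cons ?big_nil ?addn0 //.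
  - by case/andP: up.
  - have := mem3 a; have := mem3 b; rewrite !inE !eqxx !orbT /= /n; lia.
  move=> j jn jab; apply/eqP; rewrite -leqn0 (leq_trans (XG _ _)) // GfE //.
    rewrite /f; case: ifP => // /and3P[_ j3 ij].
    by move: j3; rewrite -mem3 inE (negbTE jab) orbF eq_sym (negbTE ij).
  by have := mem3 i; rewrite inE eqxx /n; lia.
have GG u v : entry G u v <= entry G u v by [].
have degG (i a b : nat) : perm_eq [:: i; a; b] [:: 0; 1; 2] ->
    degree G (inord i) = m + m'.
  move=> p3; rewrite (deg3 _ _ _ _ GG p3) -ss.
  have up : uniq [:: i; a; b] by rewrite (perm_uniq p3).
  have mem3 x : x \in [:: i; a; b] -> x < 3.
    by rewrite (perm_mem p3) !inE; lia.
  have [i3 a3 b3] : [/\ i < 3, a < 3 & b < 3].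
    by split; apply: mem3; rewrite !inE eqxx ?orbT.
  move: up; rewrite /= !inE negb_or => /and3P[/andP[ia ib] _ _].
  by rewrite !GfE /f ?i3 ?a3 ?b3 ?ia ?ib //; rewrite /n; lia.
have d0 := degG 0 1 2 isT; have d1 := degG 1 0 2 isT; have d2 := degG 2 0 1 isT.
have dG i : degree G i <= if i < 3 then m + m' else 0.
  have [lti|lei] := ltnP i 3.
    rewrite -[i]inord_val; case: (nat_of_ord i) lti => [|[|[|]]] // _; lia.
  by rewrite /degree big1 // => j _; rewrite GE /f ltnNge lei.
exists G.
  split=> [|i]; last by apply: leq_trans (dG i) _; case: ifP.
  have := num_edges_bound (_ : 3 <= n.+1) dG => /(_ isT); nia.
case=> K [H [hK hH KH]].
have KG u v : entry K u v <= entry G u v by rewrite -KH entry_mgmul leq_addr.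
have := degree_tight KH hK hH d0; have := degree_tight KH hK hH d1.
have := degree_tight KH hK hH d2.
rewrite (deg3 _ 0 1 2) // (deg3 _ 1 0 2) // (deg3 _ 2 0 1) //.
rewrite (entry_sym K 1 0) (entry_sym K 2 0) (entry_sym K 2 1).
by move: om; lia.
Qed.

(* The centre [0] is joined by single edges to [c] triangles
   [3q+1, 3q+2, 3q+3], all of whose vertices have degree [2s+1]. *)
Definition windmill_mult (s c u v : nat) : nat :=
  if [|| u == v, 3 * c < u | 3 * c < v] then 0
  else if u == 0 then (v %% 3 == 0 : nat)
  else if v == 0 then (u %% 3 == 0 : nat)
  else if u.-1 %/ 3 != v.-1 %/ 3 then 0
  else if (u %% 3 == 0) || (v %% 3 == 0) then s else s.+1.

Lemma odd_even_not_split l m m' n : 0 < m' -> odd m -> ~~ odd m' ->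
  3 * m.+1 < 2 * lhat l n ->
  exists2 G : multigraph n, Gset l (m + m') n G & ~ splits l m m' G.
Proof.
move=> m'_gt0 om em' lt_lhat.
(* As [m] is odd, both sides of [lt_lhat] are even and differ by at least 2. This leaves room for
   the centre even when [n] is odd. *)
have [lt_n lt_l] : 3 * m.+1 < n /\ 3 * m.+1 + 2 <= 2 * l.
  by move: lt_lhat; rewrite /lhat; lia.
case: n lt_n {lt_lhat} => [//|n] lt_n.
pose s := (m + m')./2.
have ss : m + m' = (s + s).+1.
  by have := odd_double_half (m + m'); rewrite oddD om (negbTE em') -/s -addnn; lia.
pose f := windmill_mult s m.+1.
have f_sym i j : f i j = f j i.
  rewrite /f /windmill_mult [j == i]eq_sym [_ || (3 * _ < i)]orbC.
  rewrite [(i %% 3 == 0) || _]orbC [j.-1 %/ 3 == _]eq_sym.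
  by case: ifP => // _; case: i => [|i]; case: j => [|j].
have [||G GE] := @multigraph_of n.+1 (fun i j => f i j).
- by move=> i j; apply: f_sym.
- by move=> i; rewrite /f /windmill_mult eqxx.
have GfE i j : i < n.+1 -> j < n.+1 -> entry G i j = f i j.
  by move=> lti ltj; rewrite /entry GE !inordK.
have GG u v : entry G u v <= entry G u v by [].
have degX (X : multigraph n.+1) (i : nat) (r : seq nat) :
    (forall u v, entry X u v <= entry G u v) -> i < n.+1 ->
    uniq r -> all (fun j => j < n.+1) r -> (forall j, j \notin r -> f i j = 0) ->
    degree X (inord i) = \sum_(j <- r) entry X i j.
  move=> XG lti ur rn f0; apply: degree_entry => // j jn jr.
  by apply/eqP; rewrite -leqn0 (leq_trans (XG _ _)) // GfE // f0.
have degA (X : multigraph n.+1) q : (forall u v, entry X u v <= entry G u v) ->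
    q < m.+1 -> degree X (inord (3 * q + 1)) =
      entry X (3 * q + 1) (3 * q + 2) + entry X (3 * q + 1) (3 * q + 3).
  move=> XG qm; rewrite (degX X _ [:: 3 * q + 2; 3 * q + 3]) //.
  - by rewrite !big_cons big_nil addn0.
  - by lia.
  - by rewrite /= inE; lia.
  - by rewrite /=; lia.
  by move=> j; rewrite !inE /f /windmill_mult; do ![case: ifP]; lia.
have degB (X : multigraph n.+1) q : (forall u v, entry X u v <= entry G u v) ->
    q < m.+1 -> degree X (inord (3 * q + 2)) =
      entry X (3 * q + 2) (3 * q + 1) + entry X (3 * q + 2) (3 * q + 3).
  move=> XG qm; rewrite (degX X _ [:: 3 * q + 1; 3 * q + 3]) //.
  - by rewrite !big_cons big_nil addn0.
  - by lia.
  - by rewrite /= inE; lia.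
  - by rewrite /=; lia.
  by move=> j; rewrite !inE /f /windmill_mult; do ![case: ifP]; lia.
have degC (X : multigraph n.+1) q : (forall u v, entry X u v <= entry G u v) ->
    q < m.+1 -> degree X (inord (3 * q + 3)) =
      entry X (3 * q + 3) (3 * q + 1) + entry X (3 * q + 3) (3 * q + 2) +
      entry X (3 * q + 3) 0.
  move=> XG qm; rewrite (degX X _ [:: 3 * q + 1; 3 * q + 2; 0]) //.
  - by rewrite !big_cons big_nil addn0 addnA.
  - by lia.
  - by rewrite /= !inE; lia.
  - by rewrite /=; lia.
  by move=> j; rewrite !inE /f /windmill_mult; do ![case: ifP]; lia.
pose rim := [seq 3 * q + 3 | q <- iota 0 m.+1].
have deg0 (X : multigraph n.+1) : (forall u v, entry X u v <= entry G u v) ->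
    degree X (inord 0) = \sum_(0 <= q < m.+1) entry X 0 (3 * q + 3).
  move=> XG; rewrite (degX X _ rim) //; first by rewrite big_map.
  - by rewrite map_inj_uniq ?iota_uniq // => a b; lia.
  - by apply/allP => j /mapP[q]; rewrite mem_iota => ? ->; lia.
  move=> j jr; apply/eqP; rewrite -leqn0 leqNgt; apply: contra jr => fj.
  have [j0 [j3 jm]] : j != 0 /\ j %% 3 = 0 /\ j <= 3 * m.+1.
    by move: fj; rewrite /f /windmill_mult; do ![case: ifP]; lia.
  apply/mapP; exists (j %/ 3).-1; last by lia.
  by rewrite mem_iota; lia.
have fAB q : q < m.+1 -> entry G (3 * q + 1) (3 * q + 2) = s.+1.
  by move=> qm; rewrite GfE /f /windmill_mult; try lia; do ![case: ifP]; lia.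
have fAC q : q < m.+1 -> entry G (3 * q + 1) (3 * q + 3) = s.
  by move=> qm; rewrite GfE /f /windmill_mult; try lia; do ![case: ifP]; lia.
have fBC q : q < m.+1 -> entry G (3 * q + 2) (3 * q + 3) = s.
  by move=> qm; rewrite GfE /f /windmill_mult; try lia; do ![case: ifP]; lia.
have fC0 q : q < m.+1 -> entry G (3 * q + 3) 0 = 1.
  by move=> qm; rewrite GfE /f /windmill_mult; try lia; do ![case: ifP]; lia.
have dA q : q < m.+1 -> degree G (inord (3 * q + 1)) = m + m'.
  by move=> qm; rewrite degA // fAB // fAC //; lia.
have dB q : q < m.+1 -> degree G (inord (3 * q + 2)) = m + m'.
  by move=> qm; rewrite degB // (entry_sym G (3 * q + 2) (3 * q + 1)) fAB //
    fBC //; lia.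
have dC q : q < m.+1 -> degree G (inord (3 * q + 3)) = m + m'.
  move=> qm; rewrite degC // (entry_sym G (3 * q + 3) (3 * q + 1)) fAC //
    (entry_sym G (3 * q + 3) (3 * q + 2)) fBC // fC0 //; lia.
have dG i : degree G i <= if i < (3 * m.+1).+1 then m + m' else 0.
  have [lti|lei] := ltnP i (3 * m.+1).+1; last first.
    rewrite /degree big1 // => j _; rewrite GE /f /windmill_mult.
    by rewrite lei /= orbT.
  rewrite -[i]inord_val; set v := nat_of_ord i in lti *.
  have [->|v0] := eqVneq v 0.
    rewrite deg0 //; apply: leq_trans (_ : \sum_(0 <= q < m.+1) 1 <= _).
      rewrite big_nat [leqRHS]big_nat; apply: leq_sum => q /andP[_ qm].
      by rewrite (entry_sym G 0) fC0.
    by rewrite sum_nat_const_nat; lia.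
  have qm : v.-1 %/ 3 < m.+1 by lia.
  have [vE|[vE|vE]] : v = 3 * (v.-1 %/ 3) + 1 \/ v = 3 * (v.-1 %/ 3) + 2 \/
      v = 3 * (v.-1 %/ 3) + 3 by lia.
  - by rewrite [X in inord X]vE dA.
  - by rewrite [X in inord X]vE dB.
  - by rewrite [X in inord X]vE dC.
exists G.
  split=> [|i]; last by apply: leq_trans (dG i) _; case: ifP.
  have := num_edges_bound lt_n dG; nia.
case=> K [H [hK hH KH]].
have KG u v : entry K u v <= entry G u v by rewrite -KH entry_mgmul leq_addr.
(* The degree sum [3 * m] of the triangle in [K] is odd and equals the spoke's multiplicity plus
   twice the inner edges. *)
have spoke q : q < m.+1 -> 1 <= entry K 0 (3 * q + 3).
  move=> qm; have := degree_tight KH hK hH (dA q qm).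
  have := degree_tight KH hK hH (dB q qm); have := degree_tight KH hK hH (dC q qm).
  rewrite degA // degB // degC // (entry_sym K 0).
  rewrite (entry_sym K (3 * q + 2) (3 * q + 1)) (entry_sym K (3 * q + 3) (3 * q + 1)).
  rewrite (entry_sym K (3 * q + 3) (3 * q + 2)); move: om; lia.
have [_ /(_ (inord 0))] := hK; rewrite deg0 // leqNgt => /negP; apply.
apply: leq_trans (_ : \sum_(0 <= q < m.+1) 1 <= _).
  by rewrite sum_nat_const_nat; lia.
by rewrite big_nat [leqRHS]big_nat; apply: leq_sum => q /andP[_ qm]; apply: spoke.
Qed.

(* The equality criterion *)
From mathcomp Require Import boolp classical_sets.

Local Open Scope classical_set_scope.

Lemma lhat_bound_rat (L m : nat) :
  (((2 * L%:R - 3) / 3 <= m%:R :> rat)%R) = (2 * L <= 3 * m.+1)%N.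
Proof.
have -> : (2 * L <= 3 * m.+1)%N = ((2 * L)%:R <= (3 * m.+1)%:R :> rat)%R.
  by rewrite Num.Theory.ler_nat.
rewrite !GRing.natrM -[m.+1]addn1 GRing.natrD.
by apply/idP/idP; lra.
Qed.

Lemma Gset_mulP (l m m' n : nat) (G : multigraph n) :
  Gset_mul (Gset l m n) (Gset l m' n) G <-> splits l m m' G.
Proof.
split=> [[K hK [H hH KH]]|[K [H [hK hH KH]]]]; first by exists K, H.
by exists K => //; exists H.
Qed.

Lemma Gset_mul_sub (l m m' n : nat) :
  Gset_mul (Gset l m n) (Gset l m' n) `<=` Gset l (m + m') n.
Proof. by move=> G /Gset_mulP[K [H [hK hH <-]]]; apply: Gset_mgmul. Qed.

Lemma Gset_mul_eqP (l m m' n : nat) :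
  Gset_mul (Gset l m n) (Gset l m' n) = Gset l (m + m') n <->
  forall G : multigraph n, Gset l (m + m') n G -> splits l m m' G.
Proof.
split=> [eqG G hG|h]; first by apply/Gset_mulP; rewrite eqG.
apply/seteqP; split=> [|G /h/Gset_mulP//]; exact: Gset_mul_sub.
Qed.

Theorem theoremD (n l m m' : nat)
    (hn : (1 <= n)%N) (hm : (1 <= m)%N) (hm' : (1 <= m')%N) :
  Gset_mul (Gset l m n) (Gset l m' n) `<=` Gset l (m + m') n /\
  (Gset_mul (Gset l m n) (Gset l m' n) = Gset l (m + m') n <->
   [\/ ~~ odd m /\ ~~ odd m',
       [/\ odd m, odd m' & (lhat l n <= 1)%N]
     | [/\ odd m, ~~ odd m'
         & ((2 * (lhat l n)%:R - 3) / 3 <= m%:R :> rat)%R] \/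
       [/\ ~~ odd m, odd m'
         & ((2 * (lhat l n)%:R - 3) / 3 <= m'%:R :> rat)%R]]).
Proof.
split; first exact: Gset_mul_sub.
have evenE a : ~~ odd a -> (2 * a./2)%N = a by move=> ea; rewrite mul2n even_halfK.
(* Necessity comes from the unsplittable multigraphs, one for each parity pattern with an odd
   summand. For sufficiency an even summand, when present, is written as [2 * b] and peeled off. *)
rewrite !lhat_bound_rat Gset_mul_eqP; split=> [eqG|cases G hG].
  have [om|em] := boolP (odd m); have [om'|em'] := boolP (odd m').
  - apply: Or32; split=> //; rewrite leqNgt; apply/negP => lt.
    by have [G hG] := odd_odd_not_split om om' lt; apply; apply: eqG.
  - apply: Or33; left; split=> //; rewrite leqNgt; apply/negP => lt.
    by have [G hG] := odd_even_not_split hm' om em' lt; apply; apply: eqG.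
  - apply: Or33; right; split=> //; rewrite leqNgt; apply/negP => lt.
    have [G hG] := odd_even_not_split hm om' em lt; apply; apply: splitsC.
    by apply: eqG; rewrite addnC.
  - exact: Or31.
case: cases => [[em em']|[om om' le1]|[[om em' le]|[em om' le]]].
- by rewrite -(evenE m') //; apply: splits_even; [|left|rewrite evenE].
- exact: splits_small.
- by rewrite -(evenE m') //; apply: splits_even; [|right|rewrite evenE].
- apply: splitsC; rewrite -(evenE m) //; apply: splits_even => //; first by right.
  by rewrite evenE // addnC.
Qed.
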